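(* The complete elliptic integrals $K$ and $K'$ satisfy $$\int_0^1 \frac{1-k^2}{\sqrt{k}}K'(k)^3\,dk=4\int_0^1 \frac{1-k^2}{\sqrt{k}}K(k)K'(k)^2\,dk=12\int_0^1 \frac{1-k^2}{\sqrt{k}}K(k)^2K'(k)\,dk=\frac{80}{3}\int_0^1 \frac{1-k^2}{\sqrt{k}}K(k)^3\,dk,$$ and $$\int_0^1 \frac{k^3}{(1-k^2)^{3/4}}K(k)^3\,dk=4\int_0^1 \frac{k^3}{(1-k^2)^{3/4}}K(k)^2K'(k)\,dk=12\int_0^1 \frac{k^3}{(1-k^2)^{3/4}}K(k)K'(k)^2\,dk=\frac{80}{3}\int_0^1 \frac{k^3}{(1-k^2)^{3/4}}K'(k)^3\,dk.$$
   Context: For $0<k<1$, $$K(k)=\int_0^{\pi/2}\frac{d\theta}{\sqrt{1-k^2\sin^2\theta}},\qquad K'(k)=K\bigl(\sqrt{1-k^2}\bigr).$$ *)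

(* Defs.v *)
From HB Require Import structures.
From mathcomp Require Import all_boot all_order all_algebra.
From mathcomp Require Import all_classical all_reals all_analysis.

Set Implicit Arguments.
Unset Strict Implicit.
Unset Printing Implicit Defensive.

Import Order.TTheory GRing.Theory Num.Theory.
Import numFieldNormedType.Exports.

Local Open Scope classical_set_scope.
Local Open Scope ring_scope.

(* The argument is the modulus k (not the parameter m = k^2), with 0 < k < 1
   intended; the integrand is then continuous on the compact `[0, pi / 2]. *)
Definition ellK (R : realType) (k : R) : R :=
  \int[lebesgue_measure]_(t in `[0, pi / 2])
    (Num.sqrt (1 - k ^+ 2 * sin t ^+ 2))^-1.

Definition ellK' (R : realType) (k : R) : R := ellK (Num.sqrt (1 - k ^+ 2)).

(* Convergence of the integral of f over the open unit interval.  All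
   integrands of interest are nonnegative there, so convergence as an improper
   integral and Lebesgue integrability coincide.  It has to be asserted
   separately because the real-valued integral is total. *)
Definition integrable01 (R : realType) (f : R -> R) : Prop :=
  (@lebesgue_measure R).-integrable `]0, 1[ (EFin \o f).

Definition int01 (R : realType) (f : R -> R) : R :=
  \int[lebesgue_measure]_(k in `]0, 1[) f k.

(* Main.v *)
Require Import Defs.
From HB Require Import structures.
From mathcomp Require Import all_boot all_order all_algebra.
From mathcomp Require Import all_classical all_reals all_analysis.
From mathcomp Require Import measurable_realfun.
From mathcomp Require Import ring lra.

Set Implicit Arguments.
Unset Strict Implicit.
Unset Printing Implicit Defensive.

Import Order.TTheory GRing.Theory Num.Theory.
Import numFieldNormedType.Exports.

Local Open Scope classical_set_scope.
Local Open Scope ring_scope.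

(** Write A_mn for the integral over ]0, 1[ of K^m K'^n, and J_mn for that of
    k K^m K'^n, where m + n = 3.

    Landen's transformation l = 2√k/(1+k) multiplies K by 1+k and K' by
    (1+k)/2, so that in total degree 3 it turns the measure dl into
    (1-k^2)/√k dk up to a factor 2^n (moment_landen).  Hence the integrals of
    the first line are the 2^n A_mn; and the integral J_mn becomes 2^(1-n)
    times the integral of (1-k) K^m K'^n, which gives A_mn = (1 + 2^n/2) J_mn.
    Moreover J_mn = J_nm by k |-> √(1-k^2), a substitution which also
    exchanges the two lines of the theorem (moment_compl).  Everything is
    thus expressed by J_03 and J_12, and one more relation is needed:
    A_03 = 3 A_21 (integral_ellK'_cube).

    This relation says that K^3, as a function of the parameter k^2, has an
    imaginary part of integral zero along the cut [1, +oo[, and follows from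
    Cauchy's theorem.  The proof below is real.  In the variable l = k^2 and
    with dm(s) = ds/√(s(1-s)) on ]0, 1[, the functions 2K and 2K' are the
    integrals of |l - s|^(-1/2) dm(s) over s < l and over s > l
    (ellK_algebraic, ellK'_algebraic).  Expanding both sides of the relation
    by Tonelli's theorem, the innermost integral, over l, becomes a period
    of the elliptic curve Y^2 = X(x-X)(y-X)(z-X).  For x > y > z the left-hand
    side is its period over the oval ]0, z[ and the right-hand side its period
    over the oval ]y, x[; a Moebius involution permuting the branch points
    exchanges the two ovals (ovals_same_period).

    All integrands are nonnegative, so these identities hold in [0, +oo];
    finiteness comes from one elementary bound on K (ellK_le), applied to
    J_03. *)

(** * Change of variables on open intervals *)

Section substitution.
Context {R : realType}.
Notation mu := (@lebesgue_measure R).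
Implicit Types (F f g : R -> R) (a b c d : R).

Let lo a b n : R := a + (b - a) / n.+2%:R.
Let hi a b n : R := b - (b - a) / n.+2%:R.

Let lo_hi a b n : a < b -> [/\ a < lo a b n, lo a b n <= hi a b n & hi a b n < b].
Proof.
move=> ab; have d0 : 0 < (b - a) / n.+2%:R by rewrite divr_gt0 ?subr_gt0.
rewrite /lo /hi ltrDl d0 ltrBlDr ltrDl d0; split => //.
rewrite -subr_ge0.
have : (b - a) / n.+2%:R <= (b - a) / 2.
  by rewrite ler_pM2l ?subr_gt0// lef_pV2 ?posrE// ler_nat.
set e := _ / n.+2%:R => ?; lra.
Qed.

Let lo_hi_mono a b n m : a < b -> (n <= m)%N ->
  lo a b m <= lo a b n /\ hi a b n <= hi a b m.
Proof.
move=> ab nm; have : (b - a) / m.+2%:R <= (b - a) / n.+2%:R.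
  by rewrite ler_pM2l ?subr_gt0// lef_pV2 ?posrE// ler_nat.
by rewrite /lo /hi lerD2l lerD2l lerN2.
Qed.

Let lo_hi_cover a b x : a < x -> x < b ->
  exists n, lo a b n <= x <= hi a b n.
Proof.
move=> ax xb; have ab := lt_trans ax xb.
pose e := Num.min (x - a) (b - x).
have e0 : 0 < e by rewrite lt_min !subr_gt0 ax.
have : 0 <= (b - a) / e by rewrite ltW// divr_gt0// subr_gt0.
move=> /archi_boundP; set n := Num.bound _ => Hn; exists n.
have : (b - a) / n.+2%:R <= e.
  rewrite ler_pdivrMr// mulrC -ler_pdivrMr//.
  by rewrite (le_trans (ltW Hn))// ler_nat -addn2 leq_addr.
rewrite /lo /hi; move: (_ / _) => r.
rewrite /e le_min => /andP[? ?].
by apply/andP; split; lra.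
Qed.

Lemma measurable_fun_itvoo g a b :
  {in `]a, b[, continuous g} -> measurable_fun `]a, b[%classic g.
Proof.
move=> cg; apply: open_continuous_measurable_fun; first exact: itv_open.
by move=> x; rewrite inE/=; exact: cg.
Qed.

Lemma deriv_gt0_incr F f a b :
  {in `[a, b], continuous F} ->
  {in `]a, b[, forall x : R, is_derive x 1 F (f x)} ->
  {in `]a, b[, forall x, 0 < f x} ->
  {in `[a, b] &, {homo F : x y / x < y}}.
Proof.
move=> cF dF f0 x y; rewrite !in_itv/= => /andP[ax xb] /andP[ay yb] xy.
have sub z : z \in `]x, y[ -> z \in `]a, b[.
  rewrite !in_itv/= => /andP[xz zy].
  by rewrite (le_lt_trans ax)// (lt_le_trans zy).
have [] := @MVT R F f x y xy.
- by move=> z /sub /dF.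
- apply: continuous_in_subspaceT => z; rewrite inE/= in_itv/= => /andP[xz zy].
  by apply: cF; rewrite in_itv/= (le_trans ax)//= (le_trans zy).
- move=> z /sub /f0 fz0 /eqP; rewrite -subr_gt0 => /eqP ->.
  by rewrite mulr_gt0// subr_gt0.
Qed.

Lemma is_derive_continuous F (x l : R) : is_derive x 1 F l -> {for x, continuous F}.
Proof.
by move=> [dF _]; apply/differentiable_continuous; rewrite -derivable1_diffP.
Qed.

(** The integrand g may blow up at both ends of its interval: the theorem for
    segments is applied to an exhausting sequence and the integrals converge
    monotonically. *)
Lemma ge0_integral_subst_incr F f g a b c d : a < b ->
  F a = c -> F b = d ->
  {in `[a, b], continuous F} ->
  {in `]a, b[, forall x : R, is_derive x 1 F (f x)} ->
  {in `]a, b[, forall x, 0 < f x} ->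
  {in `]a, b[, continuous f} ->
  {in `]c, d[, continuous g} -> {in `]c, d[, forall y, 0 <= g y} ->
  (\int[mu]_(y in `]c, d[) (g y)%:E =
   \int[mu]_(x in `]a, b[) (g (F x) * f x)%:E)%E.
Proof.
move=> ab <- <- cF dF f0 cf cg g0.
have iF := deriv_gt0_incr cF dF f0.
have ainab : a \in `[a, b] by rewrite in_itv/= lexx ltW.
have binab : b \in `[a, b] by rewrite in_itv/= lexx ltW.
have oc x : x \in `]a, b[ -> x \in `[a, b] by apply: subset_itv_oo_cc.
have FI x : x \in `]a, b[ -> F x \in `]F a, F b[.
  move=> xab; have := xab; rewrite !in_itv/= => /andP[ax xb].
  by rewrite !iF// oc.
pose A n := [set` `[lo a b n, hi a b n]].
pose B n := [set` `[F (lo a b n), F (hi a b n)]].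
have loI n : lo a b n \in `]a, b[.
  have [? ? ?] := lo_hi n ab; rewrite in_itv/=; apply/andP; split; first by [].
  by apply: le_lt_trans; eassumption.
have hiI n : hi a b n \in `]a, b[.
  have [? ? ?] := lo_hi n ab; rewrite in_itv/=; apply/andP; split; last by [].
  by apply: lt_le_trans; eassumption.
have AI n : A n `<=` `]a, b[.
  move=> x; rewrite /A/= in_itv/= => /andP[lx xh].
  move: (loI n) (hiI n); rewrite !in_itv/= => /andP[al _] /andP[_ hb].
  by rewrite (lt_le_trans al)// (le_lt_trans xh).
have BI n : B n `<=` `]F a, F b[.
  move=> x; rewrite /B/= in_itv/= => /andP[lx xh].
  move: (FI _ (loI n)) (FI _ (hiI n)); rewrite !in_itv/= => /andP[al _] /andP[_ hb].
  by rewrite (lt_le_trans al)// (le_lt_trans xh).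
have iFle x y : x \in `]a, b[ -> y \in `]a, b[ -> x <= y -> F x <= F y.
  move=> xab yab; rewrite le_eqVlt => /predU1P[->//|xy].
  by apply/ltW/iF => //; exact: oc.
have UA : \bigcup_n A n = `]a, b[%classic.
  apply/seteqP; split=> [x [n _ /AI]//|x/=].
  rewrite in_itv/= => /andP[ax xb]; have [n nx] := lo_hi_cover ax xb.
  by exists n => //; rewrite /A/= in_itv/=.
have UB : \bigcup_n B n = `]F a, F b[%classic.
  apply/seteqP; split=> [x [n _ /BI]//|y/=].
  rewrite in_itv/= => /andP[ay yb].
  have [||x] := @IVT R F a b y (ltW ab).
  - apply: continuous_in_subspaceT => z; rewrite inE/=; exact: cF.
  - by rewrite ge_min le_max (ltW ay) (ltW yb) orbT.
  - rewrite in_itv/= => /andP[]; rewrite le_eqVlt => /predU1P[<- _ Fay|ax].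
      by rewrite Fay ltxx in ay.
    rewrite le_eqVlt => /predU1P[-> Fby|xb Fxy].
      by rewrite Fby ltxx in yb.
    have [n /andP[nx xn]] := lo_hi_cover ax xb.
    have xI : x \in `]a, b[ by rewrite in_itv/= ax.
    by exists n => //; rewrite /B/= in_itv/= -Fxy !iFle.
have ndA : nondecreasing_seq A.
  move=> n m nm; rewrite subsetEset => x; rewrite /A/= !in_itv/=.
  have [mn hnm] := lo_hi_mono ab nm => /andP[nx xn].
  by rewrite (le_trans mn nx) (le_trans xn hnm).
have ndB : nondecreasing_seq B.
  move=> n m nm; rewrite subsetEset => x; rewrite /B/= !in_itv/=.
  have [mn hnm] := lo_hi_mono ab nm => /andP[nx xn].
  by rewrite (le_trans _ nx) ?(le_trans xn)// iFle.
have cgF : {in `]a, b[, continuous (fun x => g (F x) * f x)}.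
  move=> x xI; apply: continuousM; last exact: cf.
  by apply: continuous_comp; [exact/cF/oc|exact/cg/FI].
have mg : measurable_fun `]F a, F b[%classic (fun x => (g x)%:E).
  by apply/measurable_EFinP; apply: measurable_fun_itvoo.
have mgF : measurable_fun `]a, b[%classic (fun x => (g (F x) * f x)%:E).
  by apply/measurable_EFinP; apply: measurable_fun_itvoo.
have gF0 x : x \in `]a, b[ -> 0 <= g (F x) * f x.
  by move=> xI; apply: mulr_ge0; [exact/g0/FI|exact/ltW/f0].
have mA n : measurable (A n) by exact: measurable_itv.
have mB n : measurable (B n) by exact: measurable_itv.
have cvA : ((\int[mu]_(x in A i) (g (F x) * f x)%:E)%E @[i --> \oo] -->
    (\int[mu]_(x in \bigcup_i A i) (g (F x) * f x)%:E)%E).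
  apply: ge0_nondecreasing_set_cvg_integral => // [i|i x /AI xI]; last by rewrite lee_fin gF0.
  by apply: (measurable_funS _ _ mgF); [exact: measurable_itv|exact: AI].
have cvB : ((\int[mu]_(x in B i) (g x)%:E)%E @[i --> \oo] -->
    (\int[mu]_(x in \bigcup_i B i) (g x)%:E)%E).
  apply: ge0_nondecreasing_set_cvg_integral => // [i|i x /BI xI]; last by rewrite lee_fin g0.
  by apply: (measurable_funS _ _ mg); [exact: measurable_itv|exact: BI].
rewrite UA in cvA; rewrite UB in cvB.
apply: (cvg_unique _ cvB) => //; apply: cvg_trans cvA.
rewrite (_ : (fun i => _) = (fun i => (\int[mu]_(x in B i) (g x)%:E)%E))//.
apply/funext => n; have [aln lhn hbn] := lo_hi n ab.
have ccI x : x \in `[lo a b n, hi a b n] -> x \in `]a, b[ by exact: AI.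
have F'E x : x \in `]a, b[ -> F^`()%classic x = f x.
  by move=> /dF dFx; rewrite derive1E; exact: derive_val.
have cF' x : x \in `]a, b[ -> {for x, continuous F^`()%classic}.
  move=> xI.
  rewrite /prop_for/continuous_at F'E//; apply: cvg_trans (cf _ xI).
  apply: near_eq_cvg; near=> z; apply/esym/F'E.
  by near: z; exact: near_in_itvoo.
rewrite [RHS](@integration_by_substitution_increasing R F g (lo a b n) (hi a b n))//.
- by apply: eq_integral => x; rewrite inE/= => /ccI /F'E <-.
- by move=> x y /ccI/oc ? /ccI/oc ?; exact: iF.
- by move=> x /subset_itv_oo_cc/ccI/cF'.
- by apply: cvgP; exact/cvg_at_right_filter/cF'.
- by apply: cvgP; exact/cvg_at_left_filter/cF'.
- split.
  + by move=> x /subset_itv_oo_cc/ccI/dF[].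
  + exact/cvg_at_right_filter/cF/oc.
  + exact/cvg_at_left_filter/cF/oc.
- apply: continuous_in_subspaceT => y; rewrite inE/= => yB; apply: cg.
  exact: (BI n y yB).
Unshelve. all: by end_near. Qed.

(** Reflection turns a decreasing substitution into an increasing one. *)
Lemma ge0_integral_itvN (h : R -> \bar R) a b :
  measurable_fun `]a, b[%classic h -> (forall y, 0 <= h y)%E ->
  (\int[mu]_(y in `]a, b[) h y =
   \int[mu]_(x in `](- b)%R, (- a)%R[) h (- x)%R)%E.
Proof.
move=> mh h0; rewrite (_ : `](- b), (- a)[%classic =
    (-%R : _ -> measurableTypeR R) @^-1` `]a, b[); last first.
  by rewrite opp_preimage_itvbndbnd.
rewrite -ge0_integral_pushforward//=.
by apply: eq_measure_integral => //= A mA AS; exact/esym/lebesgue_measureN.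
Qed.

Lemma ge0_integral_subst_decr F f g a b c d : a < b ->
  F a = d -> F b = c ->
  {in `[a, b], continuous F} ->
  {in `]a, b[, forall x : R, is_derive x 1 F (- f x)} ->
  {in `]a, b[, forall x, 0 < f x} ->
  {in `]a, b[, continuous f} ->
  {in `]c, d[, continuous g} -> {in `]c, d[, forall y, 0 <= g y} ->
  (\int[mu]_(y in `]c, d[) (g y)%:E =
   \int[mu]_(x in `]a, b[) (g (F x) * f x)%:E)%E.
Proof.
move=> ab Fa Fb cF dF f0 cf cg g0.
have NI y : y \in `](- d), (- c)[ -> - y \in `]c, d[.
  by rewrite !in_itv/= ltrNl ltrNr andbC.
(* The reflection lemma wants a function nonnegative everywhere. *)
pose h y := (Num.max (g y) 0)%:E : \bar R.
have gh y : y \in `]c, d[ -> h y = (g y)%:E by move=> /g0 ?; rewrite /h max_l.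
transitivity (\int[mu]_(y in `]c, d[) h y)%E.
  by apply: eq_integral => y; rewrite inE/= => /gh.
rewrite ge0_integral_itvN//; last 2 first.
- have mg := measurable_fun_itvoo cg.
  by apply/measurable_EFinP; exact: measurable_maxr.
- by move=> y; rewrite lee_fin le_max lexx orbT.
transitivity (\int[mu]_(y in `](- d)%R, (- c)%R[) (g (- y))%:E)%E.
  by apply: eq_integral => y; rewrite inE/= => /NI/gh.
rewrite (@ge0_integral_subst_incr (fun x => - F x) f (fun x => g (- x)) a b)//.
- by apply: eq_integral => x _; rewrite opprK.
- by rewrite Fa.
- by rewrite Fb.
- by move=> x xab; apply: continuousN; exact: cF.
- by move=> x xab; rewrite -(opprK (f x)); apply: is_deriveN; exact: dF.
- move=> x /NI xcd; apply: continuous_comp; first exact: continuousN.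
  exact: cg.
- by move=> x /NI; exact: g0.
Qed.

End substitution.
(** * The kernel 1/√x *)

Section rsqrt.
Context {R : realType}.
Implicit Types x y u v w : R.

(** Extended by 0 to the nonpositive reals: products of such kernels then
    carry their own domain of integration. *)
Definition rsqrt x : R := (Num.sqrt x)^-1.

Lemma rsqrt_ge0 x : 0 <= rsqrt x.
Proof. by rewrite invr_ge0 sqrtr_ge0. Qed.

Lemma rsqrt_gt0 x : 0 < x -> 0 < rsqrt x.
Proof. by move=> x0; rewrite invr_gt0 sqrtr_gt0. Qed.

Lemma rsqrt_le0 x : x <= 0 -> rsqrt x = 0.
Proof. by move=> x0; rewrite /rsqrt ler0_sqrtr// invr0. Qed.

Lemma rsqrtM x y : 0 <= x -> rsqrt (x * y) = rsqrt x * rsqrt y.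
Proof. by move=> x0; rewrite /rsqrt sqrtrM// invfM. Qed.

Lemma rsqrt_sqr x : 0 <= x -> rsqrt (x ^+ 2) = x^-1.
Proof. by move=> x0; rewrite /rsqrt sqrtr_sqr ger0_norm. Qed.

Lemma sqr_rsqrt x : 0 <= x -> rsqrt x ^+ 2 = x^-1.
Proof. by move=> x0; rewrite /rsqrt exprVn sqr_sqrtr. Qed.

(** Reduces a substitution into a product of square roots to a rational
    identity. *)
Lemma rsqrt_scale u v w : 0 < v -> u = v ^+ 2 * w -> rsqrt u * v = rsqrt w.
Proof.
move=> v0 ->; rewrite rsqrtM ?sqr_ge0// rsqrt_sqr ?ltW//.
by rewrite mulrAC mulVf ?mul1r// gt_eqF.
Qed.

Lemma le_rsqrt x y : 0 < x -> x <= y -> rsqrt y <= rsqrt x.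
Proof.
move=> x0 xy; rewrite lef_pV2 ?posrE ?sqrtr_gt0//; last exact: lt_le_trans xy.
exact: ler_wsqrtr.
Qed.

Lemma measurable_rsqrt : measurable_fun [set: R] rsqrt.
Proof.
rewrite (_ : rsqrt = fun x => \1_(`]0, +oo[%classic) x * (x `^ (- 2^-1))).
  by apply: measurable_funM; [apply: measurable_indic; exact: measurable_itv
                             |exact: measurable_powR].
apply/funext => x; rewrite indicE.
have [x0|x0] := ltP 0 x; last first.
  by rewrite rsqrt_le0// memNset ?mul0r//= in_itv/= ltNge x0.
rewrite mem_set ?mul1r//=; last by rewrite in_itv/= x0.
by rewrite powRN powR12_sqrt// ltW.
Qed.

End rsqrt.

(** * Pointwise continuity of explicit expressions *)

Section continuity_rules.
Context {R : realType}.
Implicit Types (f g : R -> R) (x : R).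

Lemma continuous_atD f g x : {for x, continuous f} -> {for x, continuous g} ->
  {for x, continuous (fun t => f t + g t)}.
Proof. exact: continuousD. Qed.

Lemma continuous_atB f g x : {for x, continuous f} -> {for x, continuous g} ->
  {for x, continuous (fun t => f t - g t)}.
Proof. exact: continuousB. Qed.

Lemma continuous_atM f g x : {for x, continuous f} -> {for x, continuous g} ->
  {for x, continuous (fun t => f t * g t)}.
Proof. exact: continuousM. Qed.

Lemma continuous_atX f n x : {for x, continuous f} ->
  {for x, continuous (fun t => f t ^+ n)}.
Proof. by move=> cf; exact: (continuous_comp cf (@exprn_continuous R n (f x))). Qed.

Lemma continuous_atV f x : f x != 0 -> {for x, continuous f} ->
  {for x, continuous (fun t => (f t)^-1)}.
Proof. exact: continuousV. Qed.

Lemma continuous_at_sqrt f x : {for x, continuous f} ->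
  {for x, continuous (fun t => Num.sqrt (f t))}.
Proof. by move=> cf; exact: (continuous_comp cf (@sqrt_continuous R (f x))). Qed.

Lemma continuous_at_rsqrt f x : 0 < f x -> {for x, continuous f} ->
  {for x, continuous (fun t => rsqrt (f t))}.
Proof.
move=> fx0 cf; refine (continuous_atV _ (continuous_at_sqrt cf)).
by rewrite gt_eqF// sqrtr_gt0.
Qed.

Lemma continuous_at_sin f x : {for x, continuous f} -> {for x, continuous (fun t => sin (f t))}.
Proof. by move=> cf; exact: (continuous_comp cf (@continuous_sin R (f x))). Qed.

Lemma continuous_at_cos f x : {for x, continuous f} -> {for x, continuous (fun t => cos (f t))}.
Proof. by move=> cf; exact: (continuous_comp cf (@continuous_cos R (f x))). Qed.

Lemma continuous_at_id x : {for x, continuous ((fun t => t) : R -> R)}.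
Proof. exact: cvg_id. Qed.

Lemma continuous_at_cst (c x : R) : {for x, continuous ((fun=> c) : R -> R)}.
Proof. exact: cst_continuous. Qed.

End continuity_rules.

(** Decomposes an explicit expression along its head symbols and leaves the
    positivity and nonvanishing conditions as goals.  The rules are selected
    by syntactic matching, as plain application would unfold continuity into
    its filter definition. *)
Ltac continuity_at :=
  lazymatch goal with
  | |- continuous_at ?x ?f => change {for x, continuous f}
  | _ => idtac
  end;
  repeat first
  [ assumption
  | lazymatch goal with
    | |- {for _, continuous (fun _ => ?c)} => exact (@continuous_at_cst _ c _)
    | |- {for _, continuous (fun z => z)} => exact (@continuous_at_id _ _)
    | |- {for _, continuous (fun z => @?f z - @?g z)} => refine (@continuous_atB _ f g _ _ _)
    | |- {for _, continuous (fun z => @?f z + @?g z)} => refine (@continuous_atD _ f g _ _ _)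
    | |- {for _, continuous (fun z => @?f z * @?g z)} => refine (@continuous_atM _ f g _ _ _)
    | |- {for _, continuous (fun z => @?f z ^+ ?n)} => refine (@continuous_atX _ f n _ _)
    | |- {for _, continuous (fun z => (@?f z)^-1)} => refine (@continuous_atV _ f _ _ _)
    | |- {for _, continuous (fun z => rsqrt (@?f z))} => refine (@continuous_at_rsqrt _ f _ _ _)
    | |- {for _, continuous (fun z => Num.sqrt (@?f z))} => refine (@continuous_at_sqrt _ f _ _)
    | |- {for _, continuous (fun z => sin (@?f z))} => refine (@continuous_at_sin _ f _ _)
    | |- {for _, continuous (fun z => cos (@?f z))} => refine (@continuous_at_cos _ f _ _)
    end ].

(** * The complete elliptic integral *)

Section ellK.
Context {R : realType}.
Notation mu := (@lebesgue_measure R).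
Implicit Types k s t : R.

Lemma pihalf_gt0 : 0 < pi / 2 :> R.
Proof. exact: lt_le_trans ltr01 (pihalf_ge1 R). Qed.

Lemma sin_cos_itv t : t \in `]0, pi / 2[ -> [/\ 0 < sin t, 0 < cos t & sin t < 1].
Proof.
rewrite in_itv/= => /andP[t0 tpi].
have st : 0 < sin t by apply: sin_gt0_pihalf; rewrite t0.
have ct : 0 < cos t.
  by apply: cos_gt0_pihalf; rewrite tpi andbT (lt_trans _ t0)// oppr_lt0 pihalf_gt0.
by split => //; have := cos2Dsin2 t; nra.
Qed.

Lemma ellK_radicand_gt0 k t : 0 < k < 1 -> 0 < 1 - k ^+ 2 * sin t ^+ 2.
Proof.
move=> /andP[k0 k1]; have := cos2Dsin2 t; have := sqr_ge0 (cos t).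
have := sqr_ge0 (sin t); nra.
Qed.

Lemma ellK_integrand_continuous k t : 0 < k < 1 ->
  {for t, continuous (fun t => rsqrt (1 - k ^+ 2 * sin t ^+ 2))}.
Proof. by move=> k01; continuity_at; exact: ellK_radicand_gt0. Qed.

Lemma ellK_integrable k : 0 < k < 1 ->
  mu.-integrable `[0, pi / 2] (EFin \o (fun t => rsqrt (1 - k ^+ 2 * sin t ^+ 2))).
Proof.
move=> k01; apply: continuous_compact_integrable; first exact: segment_compact.
by apply: continuous_subspaceT => t; exact: ellK_integrand_continuous.
Qed.

Lemma ellKE k : 0 < k < 1 ->
  (ellK k)%:E =
  (\int[mu]_(t in `]0%R, (pi / 2)%R[) (rsqrt (1 - k ^+ 2 * sin t ^+ 2))%:E)%E.
Proof.
move=> k01; have := integrable_fin_num _ (ellK_integrable k01).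
rewrite /ellK /Rintegral => /(_ (measurable_itv _)) /fineK -> /=.
rewrite integral_itv_bndoo//; apply/measurable_EFinP.
by apply: measurable_fun_itvoo => t _; exact: ellK_integrand_continuous.
Qed.

Lemma ellK_ge0 k : 0 <= ellK k.
Proof. by apply: Rintegral_ge0 => t _; rewrite invr_ge0 sqrtr_ge0. Qed.

Lemma ellK_continuous : {in `]0, 1[, continuous (@ellK R)}.
Proof.
move=> k; rewrite in_itv/= => /andP[k0 k1].
(* Away from the modulus 1 the integrands are dominated by a constant. *)
pose v := (1 + k) / 2.
have v01 : 0 < v < 1 by rewrite /v; apply/andP; split; lra.
have kv : k \in `]0, v[%classic by rewrite inE/= in_itv/= k0 /v; lra.
apply: (@continuity_under_integral R _ _ mu
  (fun k t => rsqrt (1 - k ^+ 2 * sin t ^+ 2)) `[0, pi / 2] _ 0 v _ _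
  (fun=> rsqrt (1 - v ^+ 2)) _ _ k kv).
- exact: measurable_itv.
- move=> x /=; rewrite in_itv/= => /andP[x0 xv]; apply: ellK_integrable.
  by rewrite x0 (lt_trans xv)//; case/andP: v01.
- apply: aeW => t _ x; rewrite inE/= in_itv/= => /andP[x0 xv].
  change {for x, continuous ((fun y => rsqrt (1 - y ^+ 2 * sin t ^+ 2)) : R -> R)}; continuity_at.
  by apply: ellK_radicand_gt0; rewrite x0 (lt_trans xv)//; case/andP: v01.
- apply: continuous_compact_integrable; first exact: segment_compact.
  by apply: continuous_subspaceT => t; exact: cst_continuous.
- move=> x /=; rewrite in_itv/= => /andP[x0 xv]; apply: aeW => t _.
  rewrite ger0_norm ?rsqrt_ge0//; apply: le_rsqrt.
    by case/andP: v01 => ? ?; nra.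
  have := cos2Dsin2 t; have := sqr_ge0 (cos t); have := sqr_ge0 (sin t).
  move: (sin t ^+ 2) (cos t ^+ 2) => S C S0 C0 SC.
  have : x ^+ 2 <= v ^+ 2 by nra.
  have : 0 <= x ^+ 2 by nra.
  nra.
Qed.

(** The substitution s = k^2 sin^2 t. *)
Lemma ellK_algebraic k : 0 < k < 1 ->
  ((2 * ellK k)%:E =
   \int[mu]_(s in `]0%R, (k ^+ 2)%R[) (rsqrt (s * (1 - s) * (k ^+ 2 - s)))%:E)%E.
Proof.
move=> k01; have /andP[k0 k1] := k01.
have tr := @sin_cos_itv.
rewrite (@ge0_integral_subst_incr R (fun t => k ^+ 2 * sin t ^+ 2)
  (fun t => 2 * k ^+ 2 * sin t * cos t) _ 0 (pi / 2)).
- rewrite EFinM ellKE// -ge0_integralZl//=.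
  + apply: eq_integral => t; rewrite inE/= => /tr[st ct s1].
    rewrite -EFinM; congr EFin.
    have -> : 2 * k ^+ 2 * sin t * cos t = 2 * (k ^+ 2 * sin t * cos t) by ring.
    rewrite [RHS]mulrCA; congr (_ * _); apply/esym/rsqrt_scale.
      by rewrite !mulr_gt0// exprn_gt0.
    have := cos2Dsin2 t => /eqP; rewrite -subr_eq0 => /eqP sc.
    apply/eqP; rewrite -subr_eq0; apply/eqP.
    transitivity (- (cos t ^+ 2 + sin t ^+ 2 - 1) * (k^+4 * sin t ^+2 * (1 - k ^+ 2 * sin t ^+ 2)));
      last by rewrite sc; ring.
    ring.
  + apply/measurable_EFinP; apply: measurable_fun_itvoo => t _.
    exact: ellK_integrand_continuous.
  + by move=> t _; rewrite lee_fin rsqrt_ge0.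
- exact: pihalf_gt0.
- by rewrite sin0 expr0n mulr0.
- by rewrite sin_pihalf expr1n mulr1.
- by move=> t _; continuity_at.
- move=> t _; apply: is_derive_eq; rewrite /GRing.scale/=; ring.
- by move=> t /tr[st ct _]; rewrite !mulr_gt0// exprn_gt0.
- by move=> t _; continuity_at.
- move=> s; rewrite in_itv/= => /andP[s0 sk]; continuity_at.
  by rewrite !mulr_gt0// subr_gt0//; nra.
- by move=> s _; exact: rsqrt_ge0.
Qed.

End ellK.

(** * Landen's transformation *)

Section landen.
Context {R : realType}.
Notation mu := (@lebesgue_measure R).
Implicit Types k s t : R.

Lemma sqrt_uniq (x y : R) : 0 <= x -> x ^+ 2 = y -> Num.sqrt y = x.
Proof. by move=> x0 <-; rewrite sqrtr_sqr ger0_norm. Qed.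

Lemma sqrt_itv01 k : 0 < k < 1 -> 0 < Num.sqrt k < 1.
Proof.
move=> /andP[k0 k1]; rewrite sqrtr_gt0 k0/=.
by rewrite -[ltRHS]sqrtr1 ltr_sqrt.
Qed.

Lemma compl_itv01 k : 0 < k < 1 -> 0 < Num.sqrt (1 - k ^+ 2) < 1.
Proof. by move=> /andP[k0 k1]; apply: sqrt_itv01; apply/andP; split; nra. Qed.

Lemma ellK'_continuous : {in `]0, 1[, continuous (@ellK' R)}.
Proof.
move=> k; rewrite in_itv/= => k01.
have := @ellK_continuous R (Num.sqrt (1 - k ^+ 2)).
rewrite in_itv/= compl_itv01// => /(_ isT) cK.
refine (@continuous_comp _ _ _ (fun k => Num.sqrt (1 - k ^+ 2)) _ _ _ cK).
by continuity_at.
Qed.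

Definition landen k := 2 * Num.sqrt k / (1 + k).

Lemma landen_itv01 k : 0 < k < 1 -> 0 < landen k < 1.
Proof.
move=> k01; have /andP[r0 r1] := sqrt_itv01 k01; have /andP[k0 k1] := k01.
have k10 : 0 < 1 + k by lra.
have := sqr_sqrtr (ltW k0); rewrite /landen.
move: (Num.sqrt k) r0 r1 => r r0 r1 rk.
by rewrite !mulr_gt0 ?invr_gt0//= ltr_pdivrMr// mul1r; nra.
Qed.

Lemma landen_sqr k : 0 < k < 1 -> landen k ^+ 2 = 4 * k / (1 + k) ^+ 2.
Proof.
move=> /andP[k0 k1]; rewrite /landen !exprMn sqr_sqrtr ?ltW// exprVn.
by congr (_ * _ / _); ring.
Qed.

(** In the variable of the algebraic form, Landen's change of amplitude is the
    rational map s |-> 4ks/(k+s)^2. *)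
Lemma ellK_landen k : 0 < k < 1 -> ellK (landen k) = (1 + k) * ellK k.
Proof.
move=> k01; have /andP[k0 k1] := k01; have l01 := landen_itv01 k01.
have k1n : 1 + k != 0 by rewrite gt_eqF//; lra.
apply: (@mulfI _ 2) => //; apply: EFin_inj.
have si s : s \in `]0, k ^+ 2[ -> [/\ 0 < s, s < k & s < k ^+ 2].
  by rewrite in_itv/= => /andP[s0 sk]; split => //; nra.
have kkk : 0 < k ^+ 2 by rewrite exprn_gt0.
rewrite mulrCA ellK_algebraic// EFinM ellK_algebraic//.
rewrite (@ge0_integral_subst_incr R (fun s => 4 * k * s / (k + s) ^+ 2)
  (fun s => 4 * k * (k - s) / (k + s) ^+ 3) _ 0 (k ^+ 2))//.
- rewrite -ge0_integralZl//=.
  + apply: eq_integral => s; rewrite inE/= => /si[s0 sk skk].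
    have ksn : k + s != 0 by rewrite gt_eqF// addr_gt0.
    rewrite -EFinM; congr EFin; rewrite landen_sqr//.
    pose v := 4 * k * (k - s) / (k + s) ^+ 3 / (1 + k).
    rewrite -(@rsqrt_scale _ (4 * k * s / (k + s) ^+ 2 * (1 - 4 * k * s / (k + s) ^+ 2) *
       (4 * k / (1 + k) ^+ 2 - 4 * k * s / (k + s) ^+ 2)) v
       (s * (1 - s) * (k ^+ 2 - s))).
    * by rewrite /v; field; rewrite k1n ksn.
    * by rewrite /v !mulr_gt0 ?invr_gt0 ?exprn_gt0 ?subr_gt0//; lra.
    * by rewrite /v; field; rewrite k1n ksn.
  + apply/measurable_EFinP; apply: measurable_fun_itvoo => s /si[s0 sk skk].
    by continuity_at; rewrite !mulr_gt0 ?subr_gt0//; nra.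
  + by move=> s _; rewrite lee_fin rsqrt_ge0.
  + by rewrite lee_fin; lra.
- by rewrite mulr0 mul0r.
- rewrite landen_sqr//; field.
  by rewrite k1n/= gt_eqF// addr_gt0.
- move=> s; rewrite in_itv/= => /andP[s0 _]; continuity_at.
  by rewrite expf_neq0// gt_eqF// ltr_pwDl.
- move=> s /si[s0 sk skk].
  have ksn : (k + s) ^+ 2 != 0 by rewrite expf_neq0// gt_eqF// addr_gt0.
  have ksn' : k + s != 0 by rewrite gt_eqF// addr_gt0.
  by apply: is_derive_eq; rewrite /GRing.scale/=; field.
- move=> s /si[s0 sk skk].
  by rewrite !mulr_gt0 ?invr_gt0 ?exprn_gt0 ?subr_gt0//; lra.
- move=> s /si[s0 sk skk]; continuity_at.
  by rewrite expf_neq0// gt_eqF// addr_gt0.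
- move=> s; rewrite in_itv/= => /andP[s0 sl]; continuity_at.
  have /andP[l0 l1] := l01.
  by rewrite !mulr_gt0 ?subr_gt0//; nra.
- by move=> s _; exact: rsqrt_ge0.
Qed.

(** The same identity read at the modulus (1-k)/(1+k), whose Landen transform
    is the modulus complementary to k. *)
Lemma ellK'_landen k : 0 < k < 1 -> ellK' (landen k) = (1 + k) / 2 * ellK' k.
Proof.
move=> k01; have /andP[k0 k1] := k01.
have k1n : 1 + k != 0 by rewrite gt_eqF//; lra.
pose c := (1 - k) / (1 + k).
have c01 : 0 < c < 1.
  rewrite /c divr_gt0//=; [|lra|lra].
  by rewrite ltr_pdivrMr; lra.
have cE : landen c = Num.sqrt (1 - k ^+ 2).
  apply/esym/sqrt_uniq; first by have /andP[/ltW] := landen_itv01 c01.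
  rewrite landen_sqr// /c; field.
  by rewrite k1n/= gt_eqF//; lra.
rewrite {1}/ellK' landen_sqr// (@sqrt_uniq c).
- rewrite /ellK' -cE ellK_landen// /c; field.
  by rewrite k1n.
- by case/andP: c01 => /ltW.
- by rewrite /c; field.
Qed.

(** The algebraic form at the complementary modulus, reflected by s |-> 1 - s. *)
Lemma ellK'_algebraic k : 0 < k < 1 ->
  ((2 * ellK' k)%:E =
   \int[mu]_(s in `](k ^+ 2)%R, 1%R[) (rsqrt (s * (1 - s) * (s - k ^+ 2)))%:E)%E.
Proof.
move=> k01; have /andP[k0 k1] := k01; have c01 := compl_itv01 k01.
have kk1 : k ^+ 2 < 1 by nra.
rewrite /ellK' ellK_algebraic// sqr_sqrtr ?subr_ge0 ?ltW//.
rewrite (@ge0_integral_subst_decr R (fun s => 1 - s) (fun=> 1) _ (k ^+ 2) 1)//.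
- apply: eq_integral => s _; rewrite mulr1; congr (EFin (rsqrt _)); ring.
- by rewrite subrr.
- by move=> s _; continuity_at.
- by move=> s _; apply: is_derive_eq; rewrite /GRing.scale/=; ring.
- by move=> s _; continuity_at.
- move=> s; rewrite in_itv/= => /andP[s0 sk]; continuity_at.
  by rewrite !mulr_gt0 ?subr_gt0//; nra.
- by move=> s _; exact: rsqrt_ge0.
Qed.

End landen.

(** * Tonelli's theorem for a product of three transforms *)

Section integral_lemmas.
Context {R : realType}.
Notation mu := (@lebesgue_measure R).
Local Open Scope ereal_scope.

Lemma integral_supp (D : set R) (h : R -> \bar R) : measurable D ->
  (forall x, ~ D x -> h x = 0) -> \int[mu]_x h x = \int[mu]_(x in D) h x.
Proof.
move=> mD h0; rewrite [RHS]integral_mkcond; apply: eq_integral => x _.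
by rewrite patchE; case: ifPn => //; rewrite notin_setE => /h0.
Qed.

Lemma ge0_integral_swap (W : R -> \bar R) (h : R * R -> \bar R) :
  measurable_fun [set: R] W -> (forall x, 0 <= W x) ->
  measurable_fun [set: R * R] h -> (forall z, 0 <= h z) ->
  \int[mu]_x (W x * \int[mu]_s h (x, s)) = \int[mu]_s \int[mu]_x (W x * h (x, s)).
Proof.
move=> mW W0 mh h0.
rewrite -(fubini_tonelli (m1 := mu) (m2 := mu) (fun z => W z.1 * h z))//=.
- apply: eq_integral => x _; rewrite ge0_integralZl//=.
  exact: measurableT_comp.
- apply: emeasurable_funM => //; exact: measurableT_comp.
- by move=> z; rewrite mule_ge0.
Qed.

Lemma measurable_integral_swap (W : R -> \bar R) (h : R * R -> \bar R) :
  measurable_fun [set: R] W -> (forall x, 0 <= W x) ->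
  measurable_fun [set: R * R] h -> (forall z, 0 <= h z) ->
  measurable_fun [set: R] (fun s => \int[mu]_x (W x * h (x, s))).
Proof.
move=> mW W0 mh h0.
apply: (measurable_fun_fubini_tonelli_G (m1 := mu) (fun z => W z.1 * h z)) => /=.
- apply: emeasurable_funM => //; exact: measurableT_comp.
- by move=> z; rewrite mule_ge0.
Qed.

(** In the application N is the set of collisions between branch points, where
    the pointwise identity need not hold. *)
Lemma ge0_integral_eq_add3 (N : set R) (f f1 f2 f3 : R -> \bar R) :
  countable N ->
  measurable_fun [set: R] f -> (forall x, 0 <= f x) ->
  measurable_fun [set: R] f1 -> (forall x, 0 <= f1 x) ->
  measurable_fun [set: R] f2 -> (forall x, 0 <= f2 x) ->
  measurable_fun [set: R] f3 -> (forall x, 0 <= f3 x) ->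
  (forall x, ~ N x -> f x = f1 x + f2 x + f3 x) ->
  \int[mu]_x f x = \int[mu]_x f1 x + \int[mu]_x f2 x + \int[mu]_x f3 x.
Proof.
move=> cN mf f0 mf1 f10 mf2 f20 mf3 f30 fE.
have mf12 : measurable_fun [set: R] (fun x => f1 x + f2 x) by exact: emeasurable_funD.
rewrite -ge0_integralD// -ge0_integralD//=; last by move=> x _; rewrite adde_ge0.
apply: ge0_ae_eq_integral => //.
- exact: emeasurable_funD.
- by move=> x _; rewrite !adde_ge0.
- exists N; split.
  + exact: countable_measurable.
  + exact: countable_lebesgue_measure0.
  + by move=> x /= H; apply: contrapT => /fE fxE; apply: H.
Qed.

End integral_lemmas.

(** * The identity between two real periods *)

Section periods.
Context {R : realType}.
Notation mu := (@lebesgue_measure R).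
Implicit Types a b c x y z s l : R.

(** The two real ovals of Y^2 = X(a-X)(b-X)(c-X) carry the same
    period: the Moebius involution exchanging 0 with b and c with a maps one
    onto the other and preserves dX/Y. *)
Lemma ovals_same_period a b c : 0 < c -> c < b -> b < a ->
  (\int[mu]_(y in `]b, a[) (rsqrt (y * (a - y) * (y - b) * (y - c)))%:E =
   \int[mu]_(x in `]0%R, c[) (rsqrt (x * (a - x) * (b - x) * (c - x)))%:E)%E.
Proof.
move=> c0 cb ba.
have den x : 0 <= x <= c -> 0 < a * c - (a + c - b) * x.
  by move=> /andP[x0 xc]; nra.
have denn x : 0 <= x <= c -> a * c - (a + c - b) * x != 0.
  by move=> /den; rewrite lt0r => /andP[].
have oc x : x \in `]0, c[ -> 0 <= x <= c.
  by rewrite in_itv/= => /andP[/ltW -> /ltW ->].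
(* The involution is x |-> p(b-x)/(p-x) with p = ac/(a+c-b), whose pole p lies
   between c and b. *)
rewrite (@ge0_integral_subst_incr R
  (fun x => a * c * (b - x) / (a * c - (a + c - b) * x))
  (fun x => a * c * (a - b) * (b - c) / (a * c - (a + c - b) * x) ^+ 2) _ 0 c)//.
- apply: eq_integral => x; rewrite inE/= => xc; congr EFin.
  have dx := denn _ (oc _ xc); have dx0 := den _ (oc _ xc).
  apply: rsqrt_scale; last by field.
  by rewrite !mulr_gt0 ?invr_gt0 ?exprn_gt0 ?subr_gt0//; lra.
- by field; rewrite !gt_eqF//; lra.
- have := denn c; rewrite lexx ltW// => /(_ isT) dc; by field.
- by move=> x; rewrite in_itv/= => xc; continuity_at; exact: denn.
- move=> x /oc xc; have dx := denn _ xc.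
  by apply: is_derive_eq; rewrite /GRing.scale/=; field.
- move=> x /oc xc; have dx0 := den _ xc.
  by rewrite !mulr_gt0 ?invr_gt0 ?exprn_gt0 ?subr_gt0//; lra.
- by move=> x /oc xc; continuity_at; rewrite expf_neq0//; exact: denn.
- move=> y; rewrite in_itv/= => /andP[yb ya]; continuity_at.
  by rewrite !mulr_gt0 ?subr_gt0//; lra.
- by move=> y _; exact: rsqrt_ge0.
Qed.

(** Abel's kernel |s - l|^(-1/2); up selects the side s > l. *)
Definition sqrt_ker (up : bool) l s : R := rsqrt (if up then s - l else l - s).

Lemma sqrt_ker_ge0 up l s : 0 <= sqrt_ker up l s.
Proof. exact: rsqrt_ge0. Qed.

(** The kernels restrict this integral to a single interval, possibly empty,
    with ends among 0, x, y, z and +oo. *)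
Definition period e1 e2 e3 x y z : \bar R :=
  (\int[mu]_l (rsqrt l * sqrt_ker e1 l x * sqrt_ker e2 l y * sqrt_ker e3 l z)%:E)%E.

Lemma period_swap12 e1 e2 e3 x y z :
  period e1 e2 e3 x y z = period e2 e1 e3 y x z.
Proof. by apply: eq_integral => l _; congr EFin; ring. Qed.

Lemma period_swap23 e1 e2 e3 x y z :
  period e1 e2 e3 x y z = period e1 e3 e2 x z y.
Proof. by apply: eq_integral => l _; congr EFin; ring. Qed.

Lemma sqrt_ker_up0 l s : s <= l -> sqrt_ker true l s = 0.
Proof. by move=> sl; rewrite /sqrt_ker rsqrt_le0// subr_le0. Qed.

Lemma sqrt_ker_lo0 l s : l <= s -> sqrt_ker false l s = 0.
Proof. by move=> sl; rewrite /sqrt_ker rsqrt_le0// subr_le0. Qed.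

Lemma period_lo_up0 e3 x y z : y <= x -> period false true e3 x y z = 0%E.
Proof.
move=> yx; rewrite /period integral0_eq// => l _; congr EFin.
have [lx|xl] := leP l x; first by rewrite sqrt_ker_lo0// !(mulr0, mul0r).
by rewrite (@sqrt_ker_up0 l y) ?(le_trans yx (ltW xl))// !(mulr0, mul0r).
Qed.

Lemma period_sorted x y z : 0 < z -> z < y -> y < x ->
  period true true true x y z = period true false false x y z.
Proof.
move=> z0 zy yx; rewrite /period.
rewrite (@integral_supp _ `]0, z[)//; last first.
  move=> l /=; rewrite in_itv/= => /negP; rewrite negb_and -!leNgt => /orP[l0|zl].
    by rewrite rsqrt_le0// !mul0r.
  by rewrite (@sqrt_ker_up0 l z)// mulr0.
rewrite [RHS](@integral_supp _ `]y, x[)//; last first.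
  move=> l /=; rewrite in_itv/= => /negP; rewrite negb_and -!leNgt => /orP[ly|xl].
    by rewrite (@sqrt_ker_lo0 l y)// mulr0 mul0r.
  by rewrite sqrt_ker_up0// mulr0 !mul0r.
transitivity (\int[mu]_(l in `]0%R, z[)
    (rsqrt (l * (x - l) * (y - l) * (z - l)))%:E)%E.
  apply: eq_integral => l; rewrite inE/= in_itv/= => /andP[l0 lz].
  by congr EFin; rewrite /sqrt_ker !rsqrtM// ?mulr_ge0 ?subr_ge0// ?ltW//; lra.
rewrite -ovals_same_period//.
apply: eq_integral => l; rewrite inE/= in_itv/= => /andP[ly lx].
by congr EFin; rewrite /sqrt_ker !rsqrtM// ?mulr_ge0 ?subr_ge0// ?ltW//; lra.
Qed.

(** On the right only the term whose upper kernel sits at the largest of the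
    three points is nonzero, and it is the period over the oval between the
    two largest points.  The left-hand side is the period over the oval
    between 0 and the smallest point. *)
Lemma period_identity x y z : 0 < x -> 0 < y -> 0 < z ->
  x != y -> y != z -> x != z ->
  (period true true true x y z =
   period true false false x y z + period false true false x y z +
   period false false true x y z)%E.
Proof.
pose S x y z := (period true true true x y z =
   period true false false x y z + period false true false x y z +
   period false false true x y z)%E.
have S12 u v w : S u v w -> S v u w.
  rewrite /S (period_swap12 true true true v) (period_swap12 true false false v).
  rewrite (period_swap12 false true false v) (period_swap12 false false true v) => ->.
  by rewrite [X in (X + _)%E]addeC.
have S23 u v w : S u v w -> S u w v.
  rewrite /S (period_swap23 true true true u w) (period_swap23 true false false u w).
  rewrite (period_swap23 false true false u w) (period_swap23 false false true u w).
  by move=> ->; rewrite addeAC.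
have Ssort u v w : 0 < w -> w < v -> v < u -> S u v w.
  move=> w0 wv vu; rewrite /S period_sorted// [X in (_ + X + _)%E]period_lo_up0 ?ltW//.
  rewrite [X in (_ + X)%E]period_swap23 period_lo_up0 ?adde0//.
  exact: ltW (lt_trans wv vu).
move=> x0 y0 z0 xy yz xz; rewrite -/(S x y z).
have [yx|{}xy|/eqP] := ltgtP y x; last by rewrite eq_sym (negbTE xy).
- have [zy|{}yz|/eqP] := ltgtP z y; last by rewrite eq_sym (negbTE yz).
    exact: Ssort.
  have [zx|{}xz|/eqP] := ltgtP z x; last by rewrite eq_sym (negbTE xz).
    exact/S23/Ssort.
  exact/S23/S12/Ssort.
- have [zx|{}xz|/eqP] := ltgtP z x; last by rewrite eq_sym (negbTE xz).
    exact/S12/Ssort.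
  have [zy|{}yz|/eqP] := ltgtP z y; last by rewrite eq_sym (negbTE yz).
    exact/S12/S23/Ssort.
  exact/S12/S23/S12/Ssort.
Qed.

End periods.

(** * The cubic relation between K and K' *)

Section triple_integral.
Context {R : realType}.
Notation mu := (@lebesgue_measure R).
Implicit Types (k l s x y z : R) (e : bool).
Local Open Scope ereal_scope.

(** The density of the measure dm; it vanishes outside ]0, 1[, so that all the
    integrals of this part run over the whole line. *)
Definition branch_weight s : R := rsqrt (s * (1 - s)).

Definition abel_kernel e (p : R * R) : \bar R :=
  (branch_weight p.2 * sqrt_ker e p.1 p.2)%:E.

(** On ]0, 1[ this is 2K, for e = false, or 2K', for e = true, at the modulus √l. *)
Definition abel e l : \bar R := \int[mu]_s abel_kernel e (l, s).

Definition rsqrtE l : \bar R := (rsqrt l)%:E.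

Let measurable_abel_kernel e : measurable_fun [set: R * R] (abel_kernel e).
Proof.
apply/measurable_EFinP; apply: measurable_funM; apply: (measurableT_comp measurable_rsqrt).
  apply: measurable_funM => //; exact: measurable_funB.
by case: e; exact: measurable_funB.
Qed.

Let abel_kernel_ge0 e p : 0 <= abel_kernel e p.
Proof. by rewrite lee_fin mulr_ge0 ?rsqrt_ge0 ?sqrt_ker_ge0. Qed.

Let measurable_abel_kernel1 e x : measurable_fun [set: R] (fun l => abel_kernel e (l, x)).
Proof. exact: measurable_fun_pair1. Qed.

Let measurable_abel e : measurable_fun [set: R] (abel e).
Proof.
exact: (measurable_fun_fubini_tonelli_F (m2 := mu) (abel_kernel e)
  (measurable_abel_kernel e) (abel_kernel_ge0 e)).
Qed.

Let abel_ge0 e l : 0 <= abel e l.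
Proof. exact: integral_ge0. Qed.

Let measurable_rsqrtE : measurable_fun [set: R] rsqrtE.
Proof. by apply/measurable_EFinP; exact: measurable_rsqrt. Qed.

Let rsqrtE_ge0 l : 0 <= rsqrtE l.
Proof. by rewrite lee_fin rsqrt_ge0. Qed.

Definition triple e1 e2 e3 : \bar R := \int[mu]_l (rsqrtE l * abel e1 l * abel e2 l * abel e3 l).

(* The transforms are expanded one at a time: Gi is the integrand that remains
   once i of the variables x, y, z have been moved outside, and Wi collects
   its factors other than the last kernel. *)
Let W1 e2 e3 l := rsqrtE l * abel e2 l * abel e3 l.
Let W2 e1 e3 x l := rsqrtE l * abel_kernel e1 (l, x) * abel e3 l.
Let W3 e1 e2 x y l := rsqrtE l * abel_kernel e1 (l, x) * abel_kernel e2 (l, y).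

Let G1 e1 e2 e3 x := \int[mu]_l (W1 e2 e3 l * abel_kernel e1 (l, x)).
Let G2 e1 e2 e3 x y := \int[mu]_l (W2 e1 e3 x l * abel_kernel e2 (l, y)).
Let G3 e1 e2 e3 x y z := \int[mu]_l (W3 e1 e2 x y l * abel_kernel e3 (l, z)).

Let mW1 e2 e3 : measurable_fun [set: R] (W1 e2 e3).
Proof. by apply: emeasurable_funM; [apply: emeasurable_funM|]. Qed.

Let mW2 e1 e3 x : measurable_fun [set: R] (W2 e1 e3 x).
Proof. by apply: emeasurable_funM; [apply: emeasurable_funM|]. Qed.

Let mW3 e1 e2 x y : measurable_fun [set: R] (W3 e1 e2 x y).
Proof. by apply: emeasurable_funM; [apply: emeasurable_funM|]. Qed.

Let W1_ge0 e2 e3 l : 0 <= W1 e2 e3 l.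
Proof. by rewrite !mule_ge0. Qed.

Let W2_ge0 e1 e3 x l : 0 <= W2 e1 e3 x l.
Proof. by apply: mule_ge0; [apply: mule_ge0; [|exact: abel_kernel_ge0]|]. Qed.

Let W3_ge0 e1 e2 x y l : 0 <= W3 e1 e2 x y l.
Proof. by apply: mule_ge0; [apply: mule_ge0; [|exact: abel_kernel_ge0]|exact: abel_kernel_ge0]. Qed.

Let tripleE e1 e2 e3 : triple e1 e2 e3 = \int[mu]_x G1 e1 e2 e3 x.
Proof.
transitivity (\int[mu]_l (W1 e2 e3 l * abel e1 l)); last first.
  exact: (@ge0_integral_swap _ (W1 e2 e3) (abel_kernel e1)).
apply: eq_integral => l _.
by rewrite (muleAC (rsqrtE l) (abel e1 l) (abel e2 l)) (muleAC _ (abel e1 l) (abel e3 l)).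
Qed.

Let G1E e1 e2 e3 x : G1 e1 e2 e3 x = \int[mu]_y G2 e1 e2 e3 x y.
Proof.
transitivity (\int[mu]_l (W2 e1 e3 x l * abel e2 l)); last first.
  exact: (@ge0_integral_swap _ (W2 e1 e3 x) (abel_kernel e2)).
apply: eq_integral => l _.
rewrite /W1 (muleAC _ (abel e3 l)) (muleAC (rsqrtE l) (abel e2 l)).
by rewrite (muleAC (rsqrtE l * abel_kernel e1 (l, x)) (abel e2 l)).
Qed.

Let G2E e1 e2 e3 x y : G2 e1 e2 e3 x y = \int[mu]_z G3 e1 e2 e3 x y z.
Proof.
transitivity (\int[mu]_l (W3 e1 e2 x y l * abel e3 l)); last first.
  exact: (@ge0_integral_swap _ (W3 e1 e2 x y) (abel_kernel e3)).
by apply: eq_integral => l _; rewrite (muleAC _ (abel e3 l)).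
Qed.

Let mG1 e1 e2 e3 : measurable_fun [set: R] (G1 e1 e2 e3).
Proof. exact: (@measurable_integral_swap _ (W1 e2 e3) (abel_kernel e1)). Qed.

Let mG2 e1 e2 e3 x : measurable_fun [set: R] (G2 e1 e2 e3 x).
Proof. exact: (@measurable_integral_swap _ (W2 e1 e3 x) (abel_kernel e2)). Qed.

Let mG3 e1 e2 e3 x y : measurable_fun [set: R] (G3 e1 e2 e3 x y).
Proof. exact: (@measurable_integral_swap _ (W3 e1 e2 x y) (abel_kernel e3)). Qed.

Let G1_ge0 e1 e2 e3 x : 0 <= G1 e1 e2 e3 x.
Proof. by apply: integral_ge0 => l _; rewrite mule_ge0. Qed.

Let G2_ge0 e1 e2 e3 x y : 0 <= G2 e1 e2 e3 x y.
Proof. by apply: integral_ge0 => l _; rewrite mule_ge0. Qed.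

Let G3_ge0 e1 e2 e3 x y z : 0 <= G3 e1 e2 e3 x y z.
Proof. by apply: integral_ge0 => l _; rewrite mule_ge0. Qed.

Let G3E e1 e2 e3 x y z :
  G3 e1 e2 e3 x y z = (branch_weight x * branch_weight y * branch_weight z)%:E * period e1 e2 e3 x y z.
Proof.
have w0 s : (0 <= branch_weight s)%R by exact: rsqrt_ge0.
have msk e s : measurable_fun [set: R] (fun l => sqrt_ker e l s).
  by apply: (measurableT_comp measurable_rsqrt); case: e; exact: measurable_funB.
rewrite /period -ge0_integralZl_EFin//.
- by apply: eq_integral => l _; rewrite /W3 /abel_kernel /rsqrtE -!EFinM; congr EFin => /=; ring.
- by move=> l _; rewrite lee_fin !mulr_ge0 ?rsqrt_ge0 ?sqrt_ker_ge0.
- apply/measurable_EFinP.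
  by do 3! [apply: measurable_funM; last exact: msk]; exact: measurable_rsqrt.
- by rewrite !mulr_ge0.
Qed.

Lemma branch_weight0 s : ~~ (0 < s < 1)%R -> branch_weight s = 0%R.
Proof.
rewrite negb_and -!leNgt => /orP[] ?; rewrite /branch_weight rsqrt_le0//; nra.
Qed.

Let G3_sum x y z : x != y -> y != z -> x != z ->
  G3 true true true x y z =
  G3 true false false x y z + G3 false true false x y z + G3 false false true x y z.
Proof.
move=> xy yz xz; rewrite !G3E.
have [x01|/branch_weight0->] := boolP (0 < x < 1)%R; last first.
  by rewrite !mul0r !mul0e !adde0.
have [y01|/branch_weight0->] := boolP (0 < y < 1)%R; last first.
  by rewrite !(mulr0,mul0r) !mul0e !adde0.
have [z01|/branch_weight0->] := boolP (0 < z < 1)%R; last first.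
  by rewrite !mulr0 !mul0e !adde0.
have w0 s : (0 <= branch_weight s)%R by exact: rsqrt_ge0.
have p0 e1 e2 e3 : 0 <= period e1 e2 e3 x y z.
  by apply: integral_ge0 => l _; rewrite lee_fin !mulr_ge0 ?rsqrt_ge0 ?sqrt_ker_ge0.
rewrite period_identity//; try by [case/andP: x01|case/andP: y01|case/andP: z01].
rewrite (ge0_muleDr _ (adde_ge0 (p0 true false false) (p0 false true false)))//.
by rewrite (ge0_muleDr _ (p0 true false false)).
Qed.

(** After Tonelli's theorem this is the identity between periods, for almost
    every x, then almost every y given x, then almost every z given x and y. *)
Lemma triple_sum : triple true true true =
  triple true false false + triple false true false + triple false false true.
Proof.
rewrite !tripleE.
apply: (ge0_integral_eq_add3 (N := set0)) => // x _; rewrite !G1E.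
apply: (ge0_integral_eq_add3 (N := [set x])) => // y yx; rewrite !G2E.
apply: (ge0_integral_eq_add3 (N := [set x; y])) => // [|z zxy].
  exact: finite_set_countable.
by apply: G3_sum; apply/eqP => E; [apply: yx|apply: zxy; right|apply: zxy; left].
Qed.

Lemma triple_comm1 : triple false true false = triple true false false.
Proof. by apply: eq_integral => l _; rewrite (muleAC (rsqrtE l) (abel false l) (abel true l)). Qed.

Lemma triple_comm2 : triple false false true = triple true false false.
Proof. apply: eq_integral => l _; rewrite (muleAC _ (abel false l) (abel true l)).
by rewrite (muleAC (rsqrtE l) (abel false l) (abel true l)). Qed.

End triple_integral.

Section cubic.
Context {R : realType}.
Notation mu := (@lebesgue_measure R).
Implicit Types (k l s x y z : R) (e : bool).
Local Open Scope ereal_scope.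

Lemma abel_lo l : (0 < l < 1)%R -> abel false l = (2 * ellK (Num.sqrt l))%:E.
Proof.
move=> l01; have /andP[l0 l1] := l01.
have E := ellK_algebraic (sqrt_itv01 l01).
rewrite sqr_sqrtr in E; last exact: ltW.
apply: etrans (esym E).
apply: etrans (@integral_supp _ `]0%R, l[ _ (measurable_itv _) _) _.
  move=> s /=; rewrite in_itv/= => /negP; rewrite negb_and -!leNgt.
  have [/andP[s0 s1]|/branch_weight0] := boolP (0 < s < 1)%R; last first.
    by rewrite /abel_kernel/= => ->; rewrite mul0r.
  move=> /orP[|ls]; first by rewrite leNgt s0.
  by rewrite /abel_kernel (@sqrt_ker_lo0 _ l s ls) mulr0.
apply: eq_integral => s; rewrite inE/= in_itv/= => /andP[s0 sl].
rewrite /abel_kernel; congr (_%:E); apply/esym/rsqrtM.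
by apply: mulr_ge0; [exact: ltW|rewrite subr_ge0 ltW// (lt_trans sl)].
Qed.

Lemma abel_up l : (0 < l < 1)%R -> abel true l = (2 * ellK' (Num.sqrt l))%:E.
Proof.
move=> l01; have /andP[l0 l1] := l01.
have E := ellK'_algebraic (sqrt_itv01 l01).
rewrite sqr_sqrtr in E; last exact: ltW.
apply: etrans (esym E).
apply: etrans (@integral_supp _ `]l, 1%R[ _ (measurable_itv _) _) _.
  move=> s /=; rewrite in_itv/= => /negP; rewrite negb_and -!leNgt.
  have [/andP[s0 s1]|/branch_weight0] := boolP (0 < s < 1)%R; last first.
    by rewrite /abel_kernel/= => ->; rewrite mul0r.
  move=> /orP[sl|]; last by rewrite leNgt s1.
  by rewrite /abel_kernel (@sqrt_ker_up0 _ l s sl) mulr0.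
apply: eq_integral => s; rewrite inE/= in_itv/= => /andP[ls s1].
rewrite /abel_kernel; congr (_%:E); apply/esym/rsqrtM.
by apply: mulr_ge0; [apply: ltW; apply: lt_trans ls|rewrite subr_ge0 ltW].
Qed.

Lemma abel_up0 l : (1 <= l)%R -> abel true l = 0.
Proof.
move=> l1; apply: integral0_eq => s _; rewrite /abel_kernel/=.
have [/andP[s0 s1]|/branch_weight0 ->] := boolP (0 < s < 1)%R; last by rewrite mul0r.
by rewrite sqrt_ker_up0 ?mulr0// (le_trans (ltW s1)).
Qed.

(** The substitution l = k^2 from the parameter to the modulus. *)
Lemma integral_modulus (P : R -> R) : {in `]0, 1[%R, continuous P} ->
  {in `]0, 1[%R, forall k, 0 <= P k}%R ->
  \int[mu]_(l in `]0%R, 1%R[) (rsqrt l * P (Num.sqrt l))%:E =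
  \int[mu]_(k in `]0%R, 1%R[) (2 * P k)%:E.
Proof.
move=> cP P0; have s01 l : l \in `]0%R, 1%R[ -> Num.sqrt l \in `]0%R, 1%R[.
  by rewrite !in_itv/=; exact: sqrt_itv01.
rewrite (@ge0_integral_subst_incr R (fun k => k ^+ 2)%R (fun k => 2 * k)%R _ 0%R 1%R)//.
- apply: eq_integral => k; rewrite inE/= in_itv/= => /andP[k0 k1].
  rewrite rsqrt_sqr ?ltW// sqrtr_sqr ger0_norm ?ltW//; congr EFin.
  by field; rewrite gt_eqF.
- by rewrite expr0n.
- by rewrite expr1n.
- by move=> k _; continuity_at.
- by move=> k _; apply: is_derive_eq; rewrite /GRing.scale/=; ring.
- by move=> k; rewrite in_itv/= => /andP[k0 _]; rewrite mulr_gt0.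
- by move=> k _; continuity_at.
- move=> l l01; have cPl := cP _ (s01 _ l01).
  have l0 : (0 < l)%R by move: l01; rewrite in_itv/= => /andP[].
  refine (@continuous_atM _ rsqrt (P \o Num.sqrt) l _ _).
    exact: (continuous_at_rsqrt l0 (@continuous_at_id _ l)).
  exact: (continuous_comp (@sqrt_continuous R l) cPl).
- by move=> l l01; rewrite mulr_ge0 ?rsqrt_ge0// P0// s01.
Qed.

Lemma triple_modulus e2 e3 (P : R -> R) : {in `]0, 1[%R, continuous P} ->
  {in `]0, 1[%R, forall k, 0 <= P k}%R ->
  (forall l, (0 < l < 1)%R ->
     abel true l * abel e2 l * abel e3 l = (8 * P (Num.sqrt l))%:E) ->
  triple true e2 e3 = 16%:E * \int[mu]_(k in `]0%R, 1%R[) (P k)%:E.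
Proof.
move=> cP P0 KP; rewrite /triple (@integral_supp _ `]0%R, 1%R[)//; last first.
  move=> l /=; rewrite in_itv/= => /negP; rewrite negb_and -!leNgt => /orP[l0|l1].
    by rewrite /rsqrtE rsqrt_le0// !mul0e.
  by rewrite abel_up0// mule0 !mul0e.
transitivity (\int[mu]_(l in `]0%R, 1%R[) (rsqrt l * (8 * P (Num.sqrt l)))%:E).
  apply: eq_integral => l; rewrite inE/= in_itv/= => l01.
  by rewrite EFinM -KP// !muleA.
have c8P : {in `]0%R, 1%R[, continuous (fun k => 8 * P k)%R}.
  by move=> k /cP cPk; continuity_at.
rewrite (integral_modulus c8P); last by move=> k kI; rewrite mulr_ge0 ?P0.
rewrite -ge0_integralZl_EFin//.
- by apply: eq_integral => k _; rewrite -EFinM; congr EFin; ring.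
- by apply/measurable_EFinP; apply: measurable_fun_itvoo.
Qed.

(** The three terms of triple_sum are equal, whence the factor 3. *)
Lemma integral_ellK'_cube :
  \int[mu]_(k in `]0%R, 1%R[) (ellK' k ^+ 3)%:E =
  3%:E * \int[mu]_(k in `]0%R, 1%R[) (ellK k ^+ 2 * ellK' k)%:E.
Proof.
have := @triple_sum R; rewrite triple_comm1 triple_comm2.
rewrite (@triple_modulus true true (fun k => ellK' k ^+ 3)%R); last 3 first.
- by move=> k /ellK'_continuous ?; continuity_at.
- by move=> k _; rewrite exprn_ge0 ?ellK_ge0.
- by move=> l l01; rewrite abel_up// -!EFinM; congr EFin; ring.
rewrite (@triple_modulus false false (fun k => ellK k ^+ 2 * ellK' k)%R); last 3 first.
- by move=> k kI; have ? := ellK'_continuous kI; have ? := ellK_continuous kI; continuity_at.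
- by move=> k _; rewrite mulr_ge0 ?exprn_ge0 ?ellK_ge0.
- by move=> l l01; rewrite abel_up// abel_lo// -!EFinM; congr EFin; ring.
set A := \int[mu]_(_ in _) _; set B := \int[mu]_(_ in _) _ => H.
have e16 : 0 <= 16%:E :> \bar R by rewrite lee_fin.
have -> : A = (16^-1)%:E * (16%:E * A) by rewrite muleA -EFinM mulVf ?mul1e.
rewrite H -(ge0_muleDl B e16 e16) -(ge0_muleDl B (adde_ge0 e16 e16) e16).
by rewrite muleA -!EFinD -EFinM; congr (EFin _ * _); lra.
Qed.

End cubic.

(** * Weighted moments of K and K' *)

Section moments.
Context {R : realType}.
Notation mu := (@lebesgue_measure R).
Implicit Types (k : R) (w f : R -> R) (m n : nat).

Definition moment w m n : \bar R :=
  (\int[mu]_(k in `]0%R, 1%R[) (w k * ellK k ^+ m * ellK' k ^+ n)%:E)%E.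

Lemma moment_ge0 w m n : {in `]0, 1[, forall k, 0 <= w k} -> (0 <= moment w m n)%E.
Proof.
move=> w0; apply: integral_ge0 => k kI.
by rewrite lee_fin !mulr_ge0 ?exprn_ge0 ?ellK_ge0 ?w0.
Qed.

Lemma ellKX_ge0 w m n : {in `]0, 1[, forall k, 0 <= w k} ->
  {in `]0, 1[, forall k, 0 <= w k * ellK k ^+ m * ellK' k ^+ n}.
Proof. by move=> w0 k kI; rewrite !mulr_ge0 ?exprn_ge0 ?ellK_ge0 ?w0. Qed.

Lemma ellKX_continuous w m n : {in `]0, 1[, continuous w} ->
  {in `]0, 1[, continuous (fun k => w k * ellK k ^+ m * ellK' k ^+ n)}.
Proof.
move=> cw k kI; have ? := cw _ kI.
have ? := ellK_continuous kI; have ? := ellK'_continuous kI.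
by continuity_at.
Qed.

Lemma measurable_ellKX w m n : {in `]0, 1[, continuous w} ->
  measurable_fun (`]0, 1[%classic : set R) (fun k => (w k * ellK k ^+ m * ellK' k ^+ n)%:E).
Proof.
by move=> cw; apply/measurable_EFinP; apply: measurable_fun_itvoo; exact: ellKX_continuous.
Qed.

Lemma eq_moment w1 w2 m n : {in `]0, 1[, w1 =1 w2} -> moment w1 m n = moment w2 m n.
Proof. by move=> w12; apply: eq_integral => k; rewrite inE/= => /w12 ->. Qed.

Lemma momentZ (c : R) w m n : 0 <= c -> {in `]0, 1[, continuous w} ->
  {in `]0, 1[, forall k, 0 <= w k} ->
  moment (fun k => c * w k) m n = (c%:E * moment w m n)%E.
Proof.
move=> c0 cw w0; rewrite /moment -ge0_integralZl_EFin//.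
- by apply: eq_integral => k _; rewrite -EFinM !mulrA.
- by move=> k kI; rewrite lee_fin ellKX_ge0.
- exact: measurable_ellKX.
Qed.

Lemma momentD w1 w2 m n : {in `]0, 1[, continuous w1} -> {in `]0, 1[, continuous w2} ->
  {in `]0, 1[, forall k, 0 <= w1 k} -> {in `]0, 1[, forall k, 0 <= w2 k} ->
  moment (fun k => w1 k + w2 k) m n = (moment w1 m n + moment w2 m n)%E.
Proof.
move=> cw1 cw2 w10 w20; rewrite /moment -ge0_integralD//.
- by apply: eq_integral => k _; rewrite -EFinD !mulrDl.
- by move=> k kI; rewrite lee_fin ellKX_ge0.
- exact: measurable_ellKX.
- by move=> k kI; rewrite lee_fin ellKX_ge0.
- exact: measurable_ellKX.
Qed.

(** This is (1+k)^3 times the derivative of landen. *)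
Definition landen_weight k := (1 - k ^+ 2) / Num.sqrt k.

Let itv01 k : k \in `]0, 1[ -> [/\ 0 < k, k < 1, 0 < Num.sqrt k, 0 < 1 - k ^+ 2 & 1 + k != 0].
Proof.
rewrite in_itv/= => /andP[k0 k1]; split => //; first by rewrite sqrtr_gt0.
- by nra.
- by rewrite gt_eqF//; lra.
Qed.

Lemma sum3_cases m n : (m + n = 3)%N ->
  [\/ m = 0 /\ n = 3, m = 1 /\ n = 2, m = 2 /\ n = 1 | m = 3 /\ n = 0]%N.
Proof.
case: m => [|[|[|[|m]]]] => [n3|[n2]|[n1]|[n0]|//].
- by apply: Or41.
- by apply: Or42.
- by apply: Or43.
- by apply: Or44.
Qed.

(** In total degree 3 the factors 1+k that K and K' acquire combine with the
    derivative of landen into landen_weight. *)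
Lemma moment_landen w m n : (m + n = 3)%N -> {in `]0, 1[, continuous w} ->
  {in `]0, 1[, forall k, 0 <= w k} ->
  ((2 ^+ n)%:E * moment w m n =
   moment (fun k => w (landen k) * landen_weight k)%R m n)%E.
Proof.
move=> mn3 cw w0.
have dlanden k : k \in `]0, 1[ -> 0 < (1 - k) / (Num.sqrt k * (1 + k) ^+ 2).
  by move=> /itv01[k0 k1 sk0 _ _]; rewrite divr_gt0 ?subr_gt0// mulr_gt0// exprn_gt0// addr_gt0.
have clanden k : k \in `]0, 1[ -> landen k \in `]0, 1[.
  by rewrite !in_itv/=; exact: landen_itv01.
have cf k : k \in `]0, 1[ -> {for k, continuous (fun k => (1 - k) / (Num.sqrt k * (1 + k) ^+ 2))}.
  move=> /itv01[k0 k1 sk0 _ k1n]; continuity_at.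
  by rewrite mulf_neq0 ?expf_neq0// gt_eqF.
have cl k : k \in `[0, 1] -> {for k, continuous (@landen R)}.
  rewrite in_itv/= => /andP[k0 _].
  have k1n : 1 + k != 0 by rewrite gt_eqF// ltr_pwDl.
  by change {for k, continuous ((fun k => 2 * Num.sqrt k / (1 + k)) : R -> R)}; continuity_at.
rewrite /moment (@ge0_integral_subst_incr R (@landen R)
  (fun k => (1 - k) / (Num.sqrt k * (1 + k) ^+ 2)) _ 0 1)//.
- rewrite -ge0_integralZl_EFin//.
  + apply: eq_integral => k; rewrite inE/= => kI; have [k0 k1 sk0 _ k1n] := itv01 kI.
    rewrite -EFinM; congr EFin; rewrite ellK_landen ?k0// ellK'_landen ?k0//.
    have skn : Num.sqrt k != 0 by rewrite gt_eqF.
    rewrite /landen_weight.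
    by case: (sum3_cases mn3) => -[-> ->]; field; rewrite skn k1n.
  + move=> k kI; rewrite lee_fin mulr_ge0//; last exact: ltW (dlanden _ kI).
    by apply: ellKX_ge0 => //; exact: clanden.
  + apply/measurable_EFinP; apply: measurable_fun_itvoo => k kI.
    apply: (@continuous_atM _ (fun k => w (landen k) * ellK (landen k) ^+ m * ellK' (landen k) ^+ n)).
      have cE := @ellKX_continuous w m n cw _ (clanden _ kI).
      exact: (continuous_comp (cl _ (subset_itv_oo_cc kI)) cE).
    exact: cf.
- by rewrite /landen sqrtr0 mulr0 mul0r.
- by rewrite /landen sqrtr1; field.
- move=> k kI; have [k0 k1 sk0 _ k1n] := itv01 kI.
  have skn : Num.sqrt k != 0 by rewrite gt_eqF.
  have hs := @is_derive1_sqrt R k k0.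
  rewrite /landen; apply: is_derive_eq; rewrite /GRing.scale/=.
  have -> : 1 - k = 1 + k - 2 * Num.sqrt k ^+ 2 by rewrite sqr_sqrtr ?ltW//; ring.
  by field; rewrite skn k1n.
- exact: ellKX_continuous.
- exact: ellKX_ge0.
Qed.

(** The substitution k |-> √(1-k^2), which exchanges K and K'. *)
Lemma moment_compl w m n : {in `]0, 1[, continuous w} ->
  {in `]0, 1[, forall k, 0 <= w k} ->
  moment w m n =
  moment (fun k => w (Num.sqrt (1 - k ^+ 2)) * (k / Num.sqrt (1 - k ^+ 2))) n m.
Proof.
move=> cw w0; rewrite /moment.
rewrite (@ge0_integral_subst_decr R (fun k => Num.sqrt (1 - k ^+ 2))
  (fun k => k / Num.sqrt (1 - k ^+ 2)) _ 0 1)//.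
- apply: eq_integral => k; rewrite inE/= => /itv01[k0 k1 _ k2 _]; congr EFin.
  have E : ellK' (Num.sqrt (1 - k ^+ 2)) = ellK k.
    by rewrite /ellK' sqr_sqrtr ?ltW// opprB addrC subrK sqrtr_sqr ger0_norm// ltW.
  by rewrite E -/(ellK' k); ring.
- by rewrite expr0n/= subr0 sqrtr1.
- by rewrite expr1n subrr sqrtr0.
- by move=> k _; continuity_at.
- move=> k /itv01[k0 k1 _ k2 _].
  have -> : - (k / Num.sqrt (1 - k ^+ 2)) =
      (2 * Num.sqrt (1 - k ^+ 2))^-1 * (- (2 * k)).
    by field; rewrite gt_eqF// sqrtr_gt0.
  apply: (@is_derive1_comp R Num.sqrt (fun k => 1 - k ^+ 2)).
    exact: is_derive1_sqrt.
  by apply: is_derive_eq; rewrite /GRing.scale/=; ring.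
- by move=> k /itv01[k0 k1 _ k2 _]; rewrite divr_gt0// sqrtr_gt0.
- by move=> k /itv01[k0 k1 _ k2 _]; continuity_at; rewrite gt_eqF// sqrtr_gt0.
- exact: ellKX_continuous.
- exact: ellKX_ge0.
Qed.

End moments.

(** * Finiteness *)

Section finiteness.
Context {R : realType}.
Notation mu := (@lebesgue_measure R).
Implicit Types (k t : R).

(** The substitution k = v^2 makes the integrand constant. *)
Lemma integral_rsqrt : (\int[mu]_(k in `]0%R, 1%R[) (rsqrt k)%:E = 2%:E)%E.
Proof.
transitivity (\int[mu]_(k in `]0%R, 1%R[) (2 * 1)%:E)%E.
  rewrite -(@integral_modulus R (fun=> 1)) => [|k _|//]; last exact: continuous_at_cst.
  by apply: eq_integral => k _; rewrite mulr1.
rewrite integral_cst//= lebesgue_measure_itv/= lte_fin ltr01 oppr0 adde0.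
by rewrite -EFinM !mulr1.
Qed.

Lemma integral_sin_rsqrt_cos :
  (\int[mu]_(t in `]0%R, (pi / 2)%R[) (rsqrt (cos t) * sin t)%:E = 2%:E)%E.
Proof.
rewrite -integral_rsqrt (@ge0_integral_subst_decr R cos sin rsqrt 0 (pi / 2) 0 1)//.
- exact: pihalf_gt0.
- exact: cos0.
- exact: cos_pihalf.
- by move=> t _; exact: continuous_cos.
- by move=> t _; exact: is_derive_cos.
- by move=> t /sin_cos_itv[].
- by move=> t _; exact: continuous_sin.
- move=> k; rewrite in_itv/= => /andP[k0 _]; exact: (continuous_at_rsqrt k0 (@continuous_at_id _ k)).
- by move=> k _; exact: rsqrt_ge0.
Qed.

(** Since 1 <= sin + cos and cos <= √cos.  The upper bound is integrable at
    pi/2, as the substitution by cos shows. *)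
Lemma rsqrt_cos_le t : t \in `]0, pi / 2[ -> rsqrt (cos t) <= rsqrt (cos t) * sin t + 1.
Proof.
move=> /sin_cos_itv[s0 c0 s1].
have r0 := rsqrt_gt0 c0; have := sqr_rsqrt (ltW c0).
have : cos t * (cos t)^-1 = 1 by rewrite mulfV// gt_eqF.
have := cos2Dsin2 t; move: (rsqrt (cos t)) r0 => r r0 cs cc rr.
rewrite -rr in cc.
have r1 : 1 - sin t <= cos t by nra.
have : r * (1 - sin t) <= r * cos t by rewrite ler_pM2l.
have : r * cos t <= 1.
  have : 0 <= r * cos t by apply: mulr_ge0; exact: ltW.
  nra.
lra.
Qed.

(** An integrable majorant: 1 - k^2 sin^2 = p^2 + c^2 - p^2c^2 >= pc, where
    p = √(1-k^2) and c = cos. *)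
Lemma ellK_le k : 0 < k < 1 ->
  ellK k <= (2 + pi / 2) * rsqrt (Num.sqrt (1 - k ^+ 2)).
Proof.
move=> k01; have /andP[p0 p1] := compl_itv01 k01.
have pk : Num.sqrt (1 - k ^+ 2) ^+ 2 = 1 - k ^+ 2.
  by rewrite sqr_sqrtr//; case/andP: k01; nra.
move: (Num.sqrt _) p0 p1 pk => p p0 p1 pk.
have cs t : t \in `]0, pi / 2[ -> {for t, continuous (fun t => rsqrt (cos t) * sin t)}.
  by move=> /sin_cos_itv[s0 c0 s1]; continuity_at.
have mcs : measurable_fun (`]0, pi / 2[%classic : set R) (fun t => (rsqrt (cos t) * sin t)%:E).
  by apply/measurable_EFinP; apply: measurable_fun_itvoo.
rewrite -lee_fin ellKE//.
have -> : ((2 + pi / 2) * rsqrt p)%:E = (\int[mu]_(t in `]0%R, (pi / 2)%R[)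
    (rsqrt p * (rsqrt (cos t) * sin t + 1))%:E)%E.
  under eq_integral do rewrite EFinM EFinD.
  rewrite ge0_integralZl_EFin//.
  - rewrite ge0_integralD//.
    + rewrite integral_sin_rsqrt_cos integral_cst//= lebesgue_measure_itv/= lte_fin.
      by rewrite pihalf_gt0 oppr0 adde0 mul1e -EFinD -EFinM mulrC.
    + by move=> t /sin_cos_itv[s0 c0 s1]; rewrite lee_fin mulr_ge0 ?rsqrt_ge0// ltW.
  - by move=> t /sin_cos_itv[s0 c0 s1]; rewrite -EFinD lee_fin addr_ge0// mulr_ge0 ?rsqrt_ge0// ltW.
  - exact: emeasurable_funD.
  - exact: rsqrt_ge0.
apply: ge0_le_integral => //.
- by move=> t _; rewrite lee_fin rsqrt_ge0.
- apply/measurable_EFinP; apply: measurable_fun_itvoo => t _.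
  exact: ellK_integrand_continuous.
- apply/measurable_EFinP; apply: measurable_fun_itvoo => t /sin_cos_itv[s0 c0 s1].
  by continuity_at.
- move=> t tI; have [s0 c0 s1] := sin_cos_itv tI; rewrite lee_fin.
  apply: (@le_trans _ _ (rsqrt p * rsqrt (cos t))); last first.
    by rewrite ler_wpM2l ?rsqrt_ge0// rsqrt_cos_le.
  rewrite -(rsqrtM _ (ltW p0)); apply: le_rsqrt; first exact: mulr_gt0.
  have -> : sin t ^+ 2 = 1 - cos t ^+ 2 by rewrite -(cos2Dsin2 t); ring.
  have -> : k ^+ 2 = 1 - p ^+ 2 by rewrite pk; ring.
  have c1 : cos t <= 1 by exact: cos_le1.
  have pc : 0 <= p * cos t by apply: mulr_ge0; exact: ltW.
  have : p * cos t <= 1 by apply: mulr_ile1 => //; exact: ltW.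
  have : 0 <= (p - cos t) ^+ 2 by exact: sqr_ge0.
  nra.
Qed.

(** The bound gives K' <= C/√k, and k (C/√k)^3 = C^3/√k is integrable. *)
Lemma moment_id_fin : (moment (id : R -> R) 0 3 < +oo)%E.
Proof.
pose C : R := 2 + pi / 2.
have C0 : 0 <= C by rewrite addr_ge0// ltW// pihalf_gt0.
apply: (@le_lt_trans _ _ (\int[mu]_(k in `]0%R, 1%R[) (C ^+ 3 * rsqrt k)%:E)%E).
  apply: ge0_le_integral => //.
  - by move=> k kI; apply: ellKX_ge0 => // x; rewrite in_itv/= => /andP[/ltW].
  - by apply: measurable_ellKX => k _; exact: continuous_at_id.
  - apply/measurable_EFinP; apply: measurable_fun_itvoo => k.
    rewrite in_itv/= => /andP[k0 _].
    by continuity_at.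
  - move=> k /=; rewrite in_itv/= => k01; have /andP[k0 k1] := k01.
    rewrite lee_fin expr0 mulr1.
    have := ellK_le (compl_itv01 k01); rewrite -/(ellK' k) -/C.
    rewrite sqr_sqrtr; last by rewrite subr_ge0 exprn_ile1 ?ltW.
    rewrite (_ : 1 - (1 - k ^+ 2) = k ^+ 2); last by ring.
    rewrite sqrtr_sqr (gtr0_norm k0) => Kle.
    have K3 : ellK' k ^+ 3 <= (C * rsqrt k) ^+ 3.
      by rewrite lerXn2r ?nnegrE ?ellK_ge0// mulr_ge0 ?rsqrt_ge0.
    apply: le_trans (ler_wpM2l (ltW k0) K3) _.
    rewrite exprMn mulrCA ler_wpM2l ?exprn_ge0//.
    by rewrite exprS mulrCA (sqr_rsqrt (ltW k0)) mulfV ?gt_eqF// mulr1.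
under eq_integral do rewrite EFinM.
rewrite ge0_integralZl_EFin//.
- by rewrite integral_rsqrt -EFinM ltry.
- by move=> k _; rewrite lee_fin rsqrt_ge0.
- apply/measurable_EFinP; apply: measurable_funTS; exact: measurable_rsqrt.
- exact: exprn_ge0.
Qed.

End finiteness.

(** * Values of the moments *)

Section values.
Context {R : realType}.
Implicit Types (k : R) (w f : R -> R) (m n : nat).

Lemma landen_weight_continuous : {in `]0, 1[, continuous (@landen_weight R)}.
Proof.
move=> k; rewrite in_itv/= => /andP[k0 k1].
change {for k, continuous ((fun k => (1 - k ^+ 2) / Num.sqrt k) : R -> R)}; continuity_at.
by rewrite gt_eqF// sqrtr_gt0.
Qed.

Lemma landen_weight_ge0 : {in `]0, 1[, forall k : R, 0 <= landen_weight k}.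
Proof.
move=> k; rewrite in_itv/= => /andP[k0 k1].
by rewrite divr_ge0 ?sqrtr_ge0// subr_ge0 exprn_ile1 ?ltW.
Qed.

Let A m n := @moment R (fun=> 1) m n.
Let J m n := @moment R id m n.

(* Landen's substitution in the weight 1. *)
Let moment_landen_weight m n : (m + n = 3)%N ->
  (moment landen_weight m n = (2 ^+ n)%:E * A m n)%E.
Proof.
move=> mn3; rewrite moment_landen// => [|k _]; last exact: continuous_at_cst.
by apply: eq_moment => k _; rewrite mul1r.
Qed.

Let J_sym m n : J m n = J n m.
Proof.
rewrite /J moment_compl => [|k _|k]; first last.
- by rewrite in_itv/= => /andP[/ltW].
- exact: continuous_at_id.
apply: eq_moment => k; rewrite in_itv/= => k01.
by have /andP[p0 _] := compl_itv01 k01; field; rewrite gt_eqF.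
Qed.

(* Landen's substitution turns the weight k into 2(1-k), and the weights k and
   1-k add up to 1. *)
Let A_J m n : (m + n = 3)%N -> (A m n = (1 + 2 ^+ n / 2)%:E * J m n)%E.
Proof.
move=> mn3.
have c1 : {in `]0, 1[, continuous (fun k : R => 1 - k)} by move=> k _; continuity_at.
have p1 : {in `]0, 1[, forall k : R, 0 <= 1 - k}.
  by move=> k; rewrite in_itv/= => /andP[_ /ltW]; rewrite subr_ge0.
have ci : {in `]0, 1[, continuous (id : R -> R)} by move=> k _; exact: continuous_at_id.
have p0 : {in `]0, 1[, forall k : R, 0 <= k} by move=> k; rewrite in_itv/= => /andP[/ltW].
have L := moment_landen mn3 ci p0.
rewrite (@eq_moment _ (fun k => id (landen k) * landen_weight k)
  (fun k => 2 * (1 - k))) in L; last first.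
  move=> k; rewrite in_itv/= => /andP[k0 k1] /=; rewrite /landen /landen_weight.
  by field; rewrite !gt_eqF ?sqrtr_gt0//; lra.
rewrite momentZ// in L.
have -> : A m n = (J m n + moment (fun k => 1 - k)%R m n)%E.
  rewrite -momentD//; apply: eq_moment => k _.
  by rewrite addrC subrK.
have -> : moment (fun k : R => 1 - k)%R m n = ((2 ^+ n / 2)%:E * J m n)%E.
  by rewrite mulrC EFinM -muleA L muleA -EFinM mulVf ?mul1e.
have J0 : (0 <= J m n)%E by exact: moment_ge0.
by rewrite EFinD ge0_muleDl ?lee_fin// ?mul1e// divr_ge0// exprn_ge0.
Qed.

(** All the moments are rational multiples of one real number. *)
Lemma moment_values : exists a : R,
  [/\ moment landen_weight 0 3 = (40 * a)%:E,
      moment landen_weight 1 2 = (10 * a)%:E,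
      moment landen_weight 2 1 = (10 / 3 * a)%:E
    & moment landen_weight 3 0 = (3 / 2 * a)%:E].
Proof.
have J03 : J 0 3 = (fine (J 0 3))%:E.
  rewrite fineK// ge0_fin_numE ?moment_id_fin// moment_ge0// => k.
  by rewrite in_itv/= => /andP[/ltW].
move: (fine _) J03 => a J03; exists a.
have A03 : A 0 3 = (5 * a)%:E.
  by rewrite A_J// J03 -EFinM; congr EFin; field.
have A3 : (A 0 3 = 3%:E * A 2 1)%E.
  apply: etrans (etrans (@integral_ellK'_cube R) _).
    by apply: eq_integral => k _; rewrite expr0 !mul1r.
  by congr (_ * _)%E; apply: eq_integral => k _; rewrite expr1 mul1r.
(* 5a = A_03 = 3 A_21 = 6 J_21 *)
have J21 : J 2 1 = (5 / 6 * a)%:E.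
  have : (6%:E * J 2 1)%E = (5 * a)%:E.
    rewrite -A03 A3 A_J// muleA -EFinM; congr (_%:E * _)%E; lra.
  move=> J6; have -> : J 2 1 = ((6^-1)%:E * (6%:E * J 2 1))%E.
    by rewrite muleA -EFinM mulVf ?mul1e.
  by rewrite J6 -EFinM; congr EFin; field.
have J12 : J 1 2 = (5 / 6 * a)%:E by rewrite J_sym.
have J30 : J 3 0 = a%:E by rewrite J_sym.
by split; rewrite moment_landen_weight// A_J//
  ?(J03, J12, J21, J30) -!EFinM; congr EFin; field.
Qed.

(** The second weight is the first one read at the complementary modulus. *)
Definition compl_weight k := k ^+ 3 / (1 - k ^+ 2) `^ (3 / 4).

Lemma compl_weightE k : 0 < k < 1 ->
  compl_weight k =
  landen_weight (Num.sqrt (1 - k ^+ 2)) * (k / Num.sqrt (1 - k ^+ 2)).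
Proof.
move=> k01; have /andP[p0 p1] := compl_itv01 k01.
have x0 : 0 < 1 - k ^+ 2 by case/andP: k01; nra.
have pw : (1 - k ^+ 2) `^ (3 / 4) =
    Num.sqrt (1 - k ^+ 2) * Num.sqrt (Num.sqrt (1 - k ^+ 2)).
  have -> : 3 / 4 = 2^-1 + 2^-1 * 2^-1 :> R by field.
  rewrite powRD; last by rewrite (gt_eqF x0) implybT.
  by rewrite powRrM !powR12_sqrt ?powR_ge0 ?sqrtr_ge0// ltW.
rewrite /compl_weight /landen_weight pw sqr_sqrtr ?ltW//.
by field; rewrite !gt_eqF// sqrtr_gt0.
Qed.

Lemma moment_compl_weight m n : moment compl_weight m n = moment (@landen_weight R) n m.
Proof.
rewrite [RHS]moment_compl.
- by apply: eq_moment => k; rewrite in_itv/= => /compl_weightE.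
- exact: landen_weight_continuous.
- exact: landen_weight_ge0.
Qed.

Lemma compl_weight_continuous : {in `]0, 1[, continuous compl_weight}.
Proof.
move=> k; rewrite in_itv/= => /andP[k0 k1].
have x0 : 0 < 1 - k ^+ 2 by nra.
have cp := is_derive_continuous (is_derive1_powR (3 / 4) x0).
have cx : {for k, continuous ((fun k => 1 - k ^+ 2) : R -> R)} by continuity_at.
refine (@continuous_atM _ (fun k => k ^+ 3) (fun k => ((1 - k ^+ 2) `^ (3 / 4))^-1) k _ _).
  by continuity_at.
refine (@continuous_atV _ (fun k => (1 - k ^+ 2) `^ (3 / 4)) k _ (continuous_comp cx cp)).
by rewrite gt_eqF// powR_gt0.
Qed.

Lemma compl_weight_ge0 : {in `]0, 1[, forall k, 0 <= compl_weight k}.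
Proof.
move=> k; rewrite in_itv/= => /andP[k0 _].
by rewrite divr_ge0 ?powR_ge0// exprn_ge0// ltW.
Qed.

Lemma integrable01_moment w m n : {in `]0, 1[, continuous w} ->
  {in `]0, 1[, forall k, 0 <= w k} -> (moment w m n < +oo)%E ->
  integrable01 (fun k => w k * ellK k ^+ m * ellK' k ^+ n).
Proof.
move=> cw w0 fin; apply/integrableP; split; first exact: measurable_ellKX.
apply: le_lt_trans fin; rewrite le_eqVlt; apply/orP; left; apply/eqP.
by apply: eq_integral => k; rewrite inE/= => kI; rewrite ger0_norm// ellKX_ge0.
Qed.

Lemma int01_moment w m n f (c : R) :
  moment w m n = c%:E -> f =1 (fun k => w k * ellK k ^+ m * ellK' k ^+ n) ->
  int01 f = c.
Proof.
by move=> mc fE; rewrite /int01 /Rintegral -[RHS]/(fine c%:E) -mc /moment;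
  congr fine; apply: eq_integral => k _; rewrite fE.
Qed.

End values.

Theorem mainTheorem8 (R : realType) :
  [/\ (forall m n : nat, (m + n = 3)%N ->
        integrable01 (fun k : R =>
          (1 - k ^+ 2) / Num.sqrt k * ellK k ^+ m * ellK' k ^+ n)),
      int01 (fun k : R => (1 - k ^+ 2) / Num.sqrt k * ellK' k ^+ 3)
      = 4 * int01 (fun k : R =>
          (1 - k ^+ 2) / Num.sqrt k * ellK k * ellK' k ^+ 2),
      4 * int01 (fun k : R =>
          (1 - k ^+ 2) / Num.sqrt k * ellK k * ellK' k ^+ 2)
      = 12 * int01 (fun k : R =>
          (1 - k ^+ 2) / Num.sqrt k * ellK k ^+ 2 * ellK' k)
    & 12 * int01 (fun k : R =>
          (1 - k ^+ 2) / Num.sqrt k * ellK k ^+ 2 * ellK' k)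
      = 80 / 3 * int01 (fun k : R =>
          (1 - k ^+ 2) / Num.sqrt k * ellK k ^+ 3)]
  /\
  [/\ (forall m n : nat, (m + n = 3)%N ->
        integrable01 (fun k : R =>
          k ^+ 3 / (1 - k ^+ 2) `^ (3 / 4) * ellK k ^+ m * ellK' k ^+ n)),
      int01 (fun k : R => k ^+ 3 / (1 - k ^+ 2) `^ (3 / 4) * ellK k ^+ 3)
      = 4 * int01 (fun k : R =>
          k ^+ 3 / (1 - k ^+ 2) `^ (3 / 4) * ellK k ^+ 2 * ellK' k),
      4 * int01 (fun k : R =>
          k ^+ 3 / (1 - k ^+ 2) `^ (3 / 4) * ellK k ^+ 2 * ellK' k)
      = 12 * int01 (fun k : R =>
          k ^+ 3 / (1 - k ^+ 2) `^ (3 / 4) * ellK k * ellK' k ^+ 2)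
    & 12 * int01 (fun k : R =>
          k ^+ 3 / (1 - k ^+ 2) `^ (3 / 4) * ellK k * ellK' k ^+ 2)
      = 80 / 3 * int01 (fun k : R =>
          k ^+ 3 / (1 - k ^+ 2) `^ (3 / 4) * ellK' k ^+ 3)].
Proof.
have [a [I03 I12 I21 I30]] := @moment_values R.
have N30 : moment (@compl_weight R) 3 0 = (40 * a)%:E by rewrite moment_compl_weight.
have N21 : moment (@compl_weight R) 2 1 = (10 * a)%:E by rewrite moment_compl_weight.
have N12 : moment (@compl_weight R) 1 2 = (10 / 3 * a)%:E by rewrite moment_compl_weight.
have N03 : moment (@compl_weight R) 0 3 = (3 / 2 * a)%:E by rewrite moment_compl_weight.
split; split.
- move=> m n mn3; apply: (@integrable01_moment R (@landen_weight R)).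
  + exact: landen_weight_continuous.
  + exact: landen_weight_ge0.
  + by case: (sum3_cases mn3) => -[-> ->]; rewrite ?(I03, I12, I21, I30) ltry.
- rewrite (int01_moment I03); last by move=> k; rewrite expr0 mulr1.
  by rewrite (int01_moment I12) => [|//]; lra.
- by rewrite (int01_moment I12)// (int01_moment I21)//; lra.
- rewrite (int01_moment I21)// (int01_moment I30); last by move=> k; rewrite expr0 mulr1.
  lra.
- move=> m n mn3; apply: (@integrable01_moment R (@compl_weight R)).
  + exact: compl_weight_continuous.
  + exact: compl_weight_ge0.
  + by case: (sum3_cases mn3) => -[-> ->]; rewrite ?(N03, N12, N21, N30) ltry.
- rewrite (int01_moment N30); last by move=> k; rewrite expr0 mulr1.
  by rewrite (int01_moment N21) => [|//]; lra.
- by rewrite (int01_moment N21)// (int01_moment N12)//; lra.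
- rewrite (int01_moment N12)// (int01_moment N03); last by move=> k; rewrite expr0 mulr1.
  lra.
Qed.
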